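(* Let $p\geq 1$, $d\geq 1$ and $r> 2$ be fixed. Let $(X_n)_{n\ge0}$ be an $\mathbb{R}^d$-valued Markov chain with transition kernel $P$ and initial distribution $\nu$, admitting a unique invariant probability measure $\pi$. Assume that there are a constant $C_0$ and a sequence $(\rho_n)_{n\geq 1}$ decreasing to $0$ with $\sum_{n\geq 1} \rho_n<\infty$ such that $$ \forall\, n\geq 1,\ \forall\, f\in L^2(\pi),\qquad \|P^nf-\pi(f)\|_{L^2(\pi)}\le C_0\,\rho_n\, \|f-\pi(f)\|_{L^2(\pi)}. $$ Assume also that $\nu$ is absolutely continuous with respect to $\pi$ and satisfies $\|d\nu/d\pi\|_{L^r(\pi)}<\infty$. Assume finally that $M_q(\pi)<\infty$ for some $q>p r/(r-1)$. Set $q_r:=q(r-1)/r$, $d_r:=d(r+1)/r$ and $\mu_N:=N^{-1}\sum_{n=1}^N\delta_{X_n}$. Then there is a constant $C$ such that for all $N\geq 1$, $$ \mathbb{E}_\nu\left(\mathcal{T}_p(\mu_N,\pi)\right) \leq C\left\{\begin{array}{ll} N^{-1/2} +N^{-(q_r-p)/q_r}& \text{if } p>d_r/2 \text{ and } q_r\ne 2p, \\ N^{-1/2} \log(1+N)+N^{-(q_r-p)/q_r} & \text{if } p=d_r/2 \text{ and } q_r\ne 2p, \\ N^{-p/d_r}+N^{-(q_r-p)/q_r} & \text{if } p\in (0,d_r/2) \text{ and } q_r\ne d_rp/(d_r-p). \end{array}\right. $$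
   Context: $\mathbb{E}_\nu$ denotes expectation for the chain started from $X_0\sim\nu$; $\pi(f)=\int f\,d\pi$. For $q>0$, $M_q(\pi):=\int_{\mathbb{R}^d}|x|^q\,\pi(dx)$, with $|\cdot|$ the Euclidean norm. For $p>0$ and probability measures $\mu,\nu$ on $\mathbb{R}^d$, $$\mathcal{T}_p(\mu,\nu)=\inf\left\{\int_{\mathbb{R}^d\times\mathbb{R}^d}|x-y|^p\,\xi(dx,dy)\;:\;\xi\in\mathcal{H}(\mu,\nu)\right\},$$ where $\mathcal{H}(\mu,\nu)$ is the set of all probability measures on $\mathbb{R}^d\times\mathbb{R}^d$ with marginals $\mu$ and $\nu$ (no $p$-th root is taken). The constant $C$ does not depend on $N$. *)

(* Defs.v *)
From HB Require Import structures.
From mathcomp Require Import all_boot all_order all_algebra.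
From mathcomp Require Import all_classical all_reals all_analysis.

Set Implicit Arguments.
Unset Strict Implicit.
Unset Printing Implicit Defensive.

Import Order.TTheory GRing.Theory Num.Theory.
Import numFieldNormedType.Exports.

Local Open Scope classical_set_scope.
Local Open Scope ring_scope.
Local Open Scope ereal_scope.

(* The space R^d is represented by [d.-tuple R]: the canonical sigma-algebra of
   this type is generated by the coordinates, i.e., it is the Borel
   sigma-algebra of R^d.  (The canonical norm on ['rV[R]_d] is the sup norm.) *)
Section euclidean.
Context {R : realType} {d : nat}.

Definition enorm (x : d.-tuple R) : R :=
  Num.sqrt (\sum_(i < d) tnth x i ^+ 2)%R.

Definition subt (x y : d.-tuple R) : d.-tuple R :=
  [tuple (tnth x i - tnth y i)%R | i < d].

Definition moment (q : R) (mu : {measure set (d.-tuple R) -> \bar R}) : \bar R :=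
  \int[mu]_x (enorm x `^ q)%:E.

Definition couplings (mu nu : {measure set (d.-tuple R) -> \bar R}) :
    set (probability (d.-tuple R * d.-tuple R)%type R) :=
  [set xi | forall A : set (d.-tuple R), measurable A ->
     xi (A `*` setT) = mu A /\ xi (setT `*` A) = nu A].

Definition transport (p : R) (mu nu : {measure set (d.-tuple R) -> \bar R}) :
    \bar R :=
  ereal_inf [set \int[xi]_z (enorm (subt z.1 z.2) `^ p)%:E |
             xi in couplings mu nu].

End euclidean.

Section markov.
Context {dT : measure_display} {T : measurableType dT} {R : realType}.
Implicit Types (P : R.-pker T ~> T).

(* N^-1 * \sum_(1 <= n <= N) \d_(x n); the value [x 0] is not used. *)
Definition empirical (x : nat -> T) (N : nat) : {measure set T -> \bar R} :=
  mscale ((N%:R^-1)%:nng)%R (msum (fun n => \d_(x n.+1)) N).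

Definition invariant_measure P (mu : {measure set T -> \bar R}) : Prop :=
  forall A, measurable A -> \int[mu]_x P x A = mu A.

Fixpoint kernel_iter P (n : nat) : R.-spker T ~> T :=
  if n is m.+1 then mkcomp_noparam P (kernel_iter P m)
  else kdirac (@measurable_id _ T setT).

(* P^n f; the real-valued integral is 0 at the points where [f] is not integrable with
   respect to P^n(x, .) and the integral is infinite or undefined. *)
Definition kernel_op P (n : nat) (f : T -> R) : T -> R :=
  fun x => (\int[kernel_iter P n x]_y f y)%R.

(* The second clause is the Markov property
   Pr(X_(n+1) \in A | sigma(X_0, ..., X_n)) = P (X_n, A) a.s.,
   with the conditional probability written out. *)
Definition markov_chain {dO : measure_display} {Omega : measurableType dO}
    (Pr : probability Omega R) P (nu : probability T R)
    (X : nat -> {RV Pr >-> T}) : Prop :=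
  (forall A, measurable A -> distribution Pr (X 0%N) A = nu A) /\
  (forall (n : nat) (A : set T) (E : set Omega), measurable A ->
     g_sigma_preimage (fun i : 'I_n.+1 => X i : Omega -> T) E ->
     Pr (E `&` X n.+1 @^-1` A) = \int[Pr]_(w in E) P (X n w) A).

End markov.

Arguments markov_chain {dT T R dO Omega} Pr P nu X.

(* Main.v *)
Require Import Defs.
From HB Require Import structures.
From mathcomp Require Import all_boot all_order all_algebra.
From mathcomp Require Import all_classical all_reals all_analysis.
From mathcomp Require finmap.
From mathcomp Require Import measurable_realfun.
From mathcomp Require Import ring lra zify.

Set Implicit Arguments.
Unset Strict Implicit.
Unset Printing Implicit Defensive.

Import Order.TTheory GRing.Theory Num.Theory.
Import numFieldNormedType.Exports.

Local Open Scope classical_set_scope.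
Local Open Scope ring_scope.
Local Open Scope charge_scope.

(** The transport cost is bounded by a multiscale discrepancy, and the
    expectation of each term of it by a variance estimate.

    Deterministic part.  Split R^d into the shells 2^(n-1) <= |x| < 2^n, and
    shell n into cubes of side 2^(n-k).  Given two probability measures mu and
    nu, couple as much mass as possible inside the cubes of the finest level,
    then as much as possible of the rest inside the cubes of the next level,
    and so on up to the whole space ([hierarchical_coupling]).  What is left of
    mu and nu after level k has total mass |mu F - nu F| on each cube F of that
    level, whence ([transport_le_multiscale]), up to a constant,
      T_p(mu, nu) <= sum_(k < L) sum_n 2^(p(n-k)) sum_F |mu F - nu F|
                     + sum_n 2^(p(n-L)) (mu + nu)(shell n).

    Probabilistic part.  Put s = 2r/(r-2), so that 1/r + 1/s + 1/2 = 1.  If u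
    and v are functions on the state space, then E (u(X_n) v(X_n)) is the
    integral of (d nu/d pi)(x) u(y) v(y) against pi(dx) P^n(x, dy), both of
    whose marginals are pi; a three-factor Hoelder inequality bounds it by the
    product of the norms of d nu/d pi in L^r(pi), u in L^s(pi) and v in
    L^2(pi) ([law_product_le]).  With u = v = 1_A this gives
    E mu_N(A) <= C pi(A)^((r-1)/r).  With u = 1_A - pi(A) and
    v = P^k 1_A - pi(A), the mixing assumption makes the covariance of 1_A(X_i)
    and 1_A(X_(i+k)) at most C rho_k pi(A)^((r-1)/r) ([covariance_le]);
    summing over i and k gives
      E |mu_N(A) - pi(A)| <= C N^(-1/2) pi(A)^((r-1)/(2r)).
    By concavity, the sum of the right-hand side over the 2^(dk) cubes of a
    shell B is at most C N^(-1/2) 2^(dk(r+1)/(2r)) pi(B)^((r-1)/(2r)), and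
    pi(shell n) is at most C 2^(-qn).

    Thus the expectation of T_p(mu_N, pi) is governed by
      sum_k sum_n 2^(p(n-k)) min(2^(-q_r n), 2^(d_r k/2) 2^(-q_r n/2) N^(-1/2)),
    as for an independent sample in dimension d_r with moments of order q_r.
    The last part computes this sum in the three regimes; L is chosen so that
    2^L >= N, which makes the remainder negligible because p >= 1. *)

(** * Identities between integrals, proved on indicators *)

Section measurable_induction.
Local Open Scope ereal_scope.
Context d (T : measurableType d) (R : realType).

Import HBNNSimple.

(** Both sides of an identity between integrals commute with nonnegative
    combinations and with monotone limits, so that this principle reduces the
    identity to indicators. *)
Lemma ge0_measurable_ind (Q : (T -> \bar R) -> Prop) :
  (forall A, measurable A -> Q (fun x => (\1_A x)%:E)) ->
  (forall (k : R) (f : T -> \bar R), (0 <= k)%R -> measurable_fun setT f ->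
     (forall x, 0 <= f x) -> Q f -> Q (fun x => k%:E * f x)) ->
  (forall f g : T -> \bar R, measurable_fun setT f -> (forall x, 0 <= f x) -> Q f ->
     measurable_fun setT g -> (forall x, 0 <= g x) -> Q g ->
     Q (fun x => f x + g x)) ->
  (forall f_ : nat -> T -> \bar R, (forall n, measurable_fun setT (f_ n)) ->
     (forall n x, 0 <= f_ n x) ->
     (forall x, nondecreasing_seq (f_ ^~ x)) ->
     (forall n, Q (f_ n)) -> Q (fun x => limn (f_ ^~ x))) ->
  forall f, measurable_fun setT f -> (forall x, 0 <= f x) -> Q f.
Proof.
move=> Q1 QZ QD Qlim f mf f0.
pose f_ := nnsfun_approx measurableT mf.
have -> : f = (fun x => limn (fun n => (f_ n x)%:E)).
  by apply/funext => x; apply/esym/cvg_lim => //; exact: cvg_nnsfun_approx.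
apply: (Qlim (fun n x => (f_ n x)%:E)).
- by move=> n; exact/measurable_EFinP.
- by move=> n x; rewrite lee_fin.
- by move=> x a b ab; rewrite lee_fin; exact/lefP/nd_nnsfun_approx.
move=> n; move: (f_ n) => {f_} h.
have mI (A : set T) : measurable A -> measurable_fun setT (fun x => (\1_A x)%:E : \bar R).
  by move=> mA; exact/measurable_EFinP/measurable_indic.
(* The values of a simple function can be listed, hence an induction on lists. *)
have -> : (fun x => (h x)%:E) =
    (fun x => \sum_(r <- finmap.enum_fset (fset_set (range h))) (r%:E * (\1_(h @^-1` [set r]) x)%:E)).
  apply/funext => x; rewrite fimfunE -fsumEFin//= (fsbig_finite _ _)//=.
pose g (s : seq R) x : \bar R := \sum_(r <- s) (r%:E * (\1_(h @^-1` [set r]) x)%:E).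
suff H s : (forall r, r \in s -> (0 <= r)%R) ->
    [/\ measurable_fun setT (g s), (forall x, 0 <= g s x) & Q (g s)].
  by apply H => r; rewrite in_fset_set // => /set_mem[x _ <-]; exact: fun_ge0.
elim: s => [_|r s IH rs].
  have -> : g [::] = (fun x => (\1_set0 x)%:E).
    by apply/funext => x; rewrite /g big_nil indic0.
  by split; [exact: mI | move=> x; rewrite lee_fin | exact: Q1].
have [|mg g0 Qg] := IH; first by move=> a ha; apply: rs; rewrite inE ha orbT.
have r0 : (0 <= r)%R by apply: rs; rewrite mem_head.
pose k x : \bar R := r%:E * (\1_(h @^-1` [set r]) x)%:E.
have mk : measurable_fun setT k.
  by apply: measurable_funeM; exact: mI.
have k0 x : 0 <= k x by apply: mule_ge0; rewrite lee_fin.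
have Qk : Q k by apply: QZ => //; [exact: mI|exact: Q1].
have -> : g (r :: s) = (fun x => k x + g s x).
  by apply/funext => x; rewrite /g big_cons.
split; [exact: emeasurable_funD| | exact: QD].
by move=> x; exact: adde_ge0.
Qed.

End measurable_induction.

Section mixture.
Local Open Scope ereal_scope.
Context d1 d2 d3 (T1 : measurableType d1) (T2 : measurableType d2)
  (U : measurableType d3) (R : realType).

(** All the changes of the order of integration needed for the chain are
    instances.  A Dirac kernel on one side yields the integral of [f] itself,
    or of [f] composed with a map; the domains make room for conditioning on
    an event. *)
Lemma ge0_eq_integral_mixture
    (mu1 : {measure set T1 -> \bar R}) (D1 : set T1) (k1 : T1 -> {measure set U -> \bar R})
    (mu2 : {measure set T2 -> \bar R}) (D2 : set T2) (k2 : T2 -> {measure set U -> \bar R}) :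
  measurable D1 -> (forall A, measurable A -> measurable_fun setT (k1 ^~ A)) ->
  measurable D2 -> (forall A, measurable A -> measurable_fun setT (k2 ^~ A)) ->
  (forall A, measurable A ->
     \int[mu1]_(x in D1) k1 x A = \int[mu2]_(x in D2) k2 x A) ->
  forall f, measurable_fun setT f -> (forall y, 0 <= f y) ->
  \int[mu1]_(x in D1) \int[k1 x]_y f y = \int[mu2]_(x in D2) \int[k2 x]_y f y.
Proof.
move=> mD1 mk1 mD2 mk2 k12.
have mI1 f : measurable_fun setT f -> (forall y, 0 <= f y) ->
    measurable_fun D1 (fun x => \int[k1 x]_y f y).
  by move=> mf f0; apply: measurable_funTS; exact: measurable_fun_integral_kernel.
have mI2 f : measurable_fun setT f -> (forall y, 0 <= f y) ->
    measurable_fun D2 (fun x => \int[k2 x]_y f y).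
  by move=> mf f0; apply: measurable_funTS; exact: measurable_fun_integral_kernel.
have I0 (m : {measure set U -> \bar R}) (f : U -> \bar R) :
    (forall y, 0 <= f y) -> 0 <= \int[m]_y f y.
  by move=> f0; exact: integral_ge0.
apply: ge0_measurable_ind.
- move=> A mA; rewrite [RHS](eq_integral (k2 ^~ A)); last first.
    by move=> x _; rewrite integral_indic// setIT.
  by rewrite -k12//; apply: eq_integral => x _; rewrite integral_indic// setIT.
- move=> c f c0 mf f0 IH.
  under eq_integral do rewrite ge0_integralZl//.
  under [in RHS]eq_integral do rewrite ge0_integralZl//.
  by rewrite !ge0_integralZl ?IH//;
    [exact: mI2|by move=> x _; exact: I0|exact: mI1|by move=> x _; exact: I0].
- move=> f g mf f0 IHf mg g0 IHg.
  under eq_integral do rewrite ge0_integralD//.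
  under [in RHS]eq_integral do rewrite ge0_integralD//.
  by rewrite [LHS]ge0_integralD 1?[RHS]ge0_integralD ?IHf ?IHg//;
    solve [exact: mI1|exact: mI2|move=> x _; exact: I0].
- move=> f mf f0 nd IH.
  have kE (m : {measure set U -> \bar R}) :
      \int[m]_y limn (f ^~ y) = limn (fun n => \int[m]_y f n y).
    by rewrite monotone_convergence.
  under eq_integral do rewrite kE.
  under [in RHS]eq_integral do rewrite kE.
  have nd' (m : {measure set U -> \bar R}) :
      {homo (fun n => \int[m]_y f n y) : a b / (a <= b)%N >-> a <= b}.
    by move=> a b ab; apply: ge0_le_integral => // y _; exact: nd.
  rewrite !monotone_convergence//.
  + by under eq_fun do rewrite IH.
  + by move=> n; exact: mI2.
  + by move=> n x _; exact: I0.
  + by move=> n; exact: mI1.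
  + by move=> n x _; exact: I0.
Qed.

End mixture.

(** * Coupling two measures along a nested sequence of partitions *)

Section density.
Local Open Scope ereal_scope.
Context d (T : measurableType d) (R : realType).

Lemma finite_density_measure (mu : {measure set T -> \bar R}) (w : T -> \bar R) :
  measurable_fun setT w -> (forall x, 0 <= w x) -> \int[mu]_x w x < +oo ->
  exists m : {finite_measure set T -> \bar R},
    forall A, measurable A -> m A = \int[mu]_x (w x * (\1_A x)%:E).
Proof.
move=> mw w0 wfin.
pose m0 (A : set T) := \int[mu]_(x in A) w x.
have m00 : m0 set0 = 0 by rewrite /m0 integral_set0.
have m0_ge0 A : 0 <= m0 A by apply: integral_ge0 => x _; exact: w0.
have m0_add : semi_sigma_additive m0.
  move=> F mF tF mUF; rewrite /m0 ge0_integral_bigcup//; last 1 first.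
    exact: measurable_funTS.
  have /cvg_ex[l hl] : cvgn (fun n => \sum_(0 <= i < n) \int[mu]_(x in F i) w x).
    by apply: is_cvg_nneseries => n _ _; apply: integral_ge0 => x _; exact: w0.
  by rewrite (cvg_lim _ hl).
pose M := isMeasure.Build d T R m0 m00 m0_ge0 m0_add.
pose m1 : {measure set T -> \bar R} := HB.pack m0 M.
have m1fin : fin_num_fun m1.
  move=> A mA; rewrite ge0_fin_numE//; apply: le_lt_trans wfin.
  by apply: ge0_subset_integral => //.
pose F := Measure_isFinite.Build d T R m1 m1fin.
pose m2 : {finite_measure set T -> \bar R} := HB.pack m0 M F.
exists m2 => A mA.
by rewrite -[LHS]/(\int[mu]_(x in A) w x) integral_mkcond epatch_indic.
Qed.

End density.

Section coupling_step.
Local Open Scope ereal_scope.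
Context d (T : measurableType d) (R : realType).

(** On each cell F = c^-1(i), [xi] is the product of the restrictions of [mu]
    and [nu], normalized to have mass min(mu F, nu F).  On F one of the two
    remainders is then zero and the other one has mass |mu F - nu F|. *)
Lemma coupling_step (mu nu : {finite_measure set T -> \bar R}) (c : T -> nat) :
  measurable_fun setT c ->
  exists (xi : {finite_measure set (T * T)%type -> \bar R})
         (mu' nu' : {finite_measure set T -> \bar R}),
    [/\ forall A, measurable A -> xi (A `*` setT) + mu' A = mu A,
        forall A, measurable A -> xi (setT `*` A) + nu' A = nu A,
        forall i, mu' (c @^-1` [set i]) + nu' (c @^-1` [set i]) =
          `|mu (c @^-1` [set i]) - nu (c @^-1` [set i])| &
        xi [set z | c z.1 <> c z.2] = 0].
Proof.
move=> mc.
pose F i := c @^-1` [set i].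
have mF i : measurable (F i) by rewrite -[F i]setTI; exact: mc.
pose a i := fine (mu (F i)); pose b i := fine (nu (F i)).
have aE i : mu (F i) = (a i)%:E by rewrite fineK// fin_num_measure.
have bE i : nu (F i) = (b i)%:E by rewrite fineK// fin_num_measure.
have a0 i : (0 <= a i)%R by rewrite fine_ge0.
have b0 i : (0 <= b i)%R by rewrite fine_ge0.
(* As 0^-1 = 0, this weight vanishes on the cells that [mu] or [nu] ignores. *)
pose f i : R := (Num.min (a i) (b i) / (a i * b i))%R.
have f0 i : (0 <= f i)%R.
  by rewrite divr_ge0 ?mulr_ge0// le_min a0 b0.
have fab i : (f i * (a i * b i) = Num.min (a i) (b i))%R.
  rewrite /f; have [->|an0] := eqVneq (a i) 0%R.
    by rewrite mul0r mulr0 min_l.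
  have [->|bn0] := eqVneq (b i) 0%R; first by rewrite !mulr0 min_r.
  by rewrite divfK// mulf_neq0.
have fa1 i : (f i * a i <= 1)%R.
  have [bi0|bn0] := eqVneq (b i) 0%R.
    by rewrite /f bi0 mulr0 invr0 mulr0 mul0r.
  have bp : (0 < b i)%R by rewrite lt0r bn0 b0.
  by rewrite -(ler_pM2r bp) -mulrA fab mul1r ge_min lexx orbT.
have fb1 i : (f i * b i <= 1)%R.
  have [ai0|an0] := eqVneq (a i) 0%R.
    by rewrite /f ai0 mul0r invr0 mulr0 mul0r.
  have ap : (0 < a i)%R by rewrite lt0r an0 a0.
  by rewrite -(ler_pM2r ap) -mulrA (mulrC (b i)) fab mul1r ge_min lexx.
have mcomp (g : nat -> R) : measurable_fun setT (fun x => (g (c x))%:E : \bar R).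
  by apply/measurable_EFinP; apply: (measurableT_comp (f := g)).
have mI (A : set T) : measurable A -> measurable_fun setT (fun x => (\1_A x)%:E : \bar R).
  by move=> mA; exact/measurable_EFinP/measurable_indic.
pose D := [set z : (T * T)%type | c z.1 = c z.2].
have mD : measurable D.
  have -> : D = (fun z : (T * T)%type => c z.1 == c z.2) @^-1` [set true].
    by apply/seteqP; split => z /=; [move=> ->; rewrite eqxx|move/eqP].
  rewrite -[X in measurable X]setTI.
  have : measurable_fun setT (fun z : (T * T)%type => c z.1 == c z.2).
    by apply: measurable_fun_eqn; exact: measurableT_comp.
  exact.
pose w (z : (T * T)%type) : \bar R := (f (c z.1))%:E * (\1_D z)%:E.
have mw : measurable_fun setT w.
  apply: emeasurable_funM; last exact/measurable_EFinP/measurable_indic.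
  exact: (measurableT_comp (mcomp f) measurable_fst).
have w0 z : 0 <= w z by rewrite mule_ge0// lee_fin.
have mw' (A : set (T * T)%type) : measurable A ->
    measurable_fun setT (fun z => w z * (\1_A z)%:E).
  by move=> mA; apply: emeasurable_funM => //; exact/measurable_EFinP/measurable_indic.
have w0' (A : set (T * T)%type) z : 0 <= w z * (\1_A z)%:E.
  by rewrite mule_ge0// lee_fin.
have w1 A : measurable A -> \int[mu \x nu]_z (w z * (\1_(A `*` setT) z)%:E) =
    \int[mu]_x ((f (c x) * b (c x))%:E * (\1_A x)%:E).
  move=> mA; rewrite fubini_tonelli1//; last by apply: mw'; exact: measurableX.
  apply: eq_integral => x _; rewrite /fubini_F.
  under eq_integral => y _.
    rewrite /w /=.
    rewrite [X in _ * X](_ : _ = (\1_A x)%:E); last first.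
      by rewrite !indicE in_setX/= in_setT andbT.
    rewrite [X in _ * X * _](_ : _ = (\1_(F (c x)) y)%:E); last first.
      rewrite !indicE; congr (_%:R%:E); congr nat_of_bool.
      by apply/idP/idP => /set_mem h; apply/mem_set => //; exact: esym.
    rewrite -muleA (muleC (\1_(F _) y)%:E) muleA.
    over.
  rewrite ge0_integralZl ?mule_ge0 ?lee_fin//; last exact: mI.
  rewrite integral_indic// setIT [X in _ * X](bE (c x)) EFinM.
  by rewrite muleAC.
have w2 A : measurable A -> \int[mu \x nu]_z (w z * (\1_(setT `*` A) z)%:E) =
    \int[nu]_y ((f (c y) * a (c y))%:E * (\1_A y)%:E).
  move=> mA; rewrite fubini_tonelli1//; last by apply: mw'; exact: measurableX.
  rewrite fubini_tonelli//; last by apply: mw'; exact: measurableX.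
  apply: eq_integral => y _; rewrite /fubini_G.
  under eq_integral => x _.
    rewrite /w /=.
    rewrite [X in _ * X](_ : _ = (\1_A y)%:E); last first.
      by rewrite !indicE in_setX/= in_setT.
    rewrite [X in X * _](_ : _ = (f (c y))%:E * (\1_(F (c y)) x)%:E); last first.
      rewrite !indicE; have [/set_mem e|ne] := boolP ((x, y) \in D).
        by rewrite mem_set//; congr (_ * _); rewrite [c x]e.
      rewrite memNset ?mule0//; last first.
        by move=> e; move/negP: ne; apply; apply/mem_set.
    rewrite -muleA (muleC (\1_(F _) x)%:E) muleA.
    over.
  rewrite ge0_integralZl ?mule_ge0 ?lee_fin//; last exact: mI.
  rewrite integral_indic// setIT [X in _ * X](aE (c y)) EFinM.
  by rewrite muleAC.
have Iden (m : {finite_measure set T -> \bar R}) (g : nat -> R) :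
    (forall i, 0 <= g i <= 1)%R -> exists m' : {finite_measure set T -> \bar R},
    forall A, measurable A -> m' A = \int[m]_x ((g (c x))%:E * (\1_A x)%:E).
  move=> g01; apply: finite_density_measure => //.
    by move=> x; rewrite lee_fin; have /andP[] := g01 (c x).
  apply: (@le_lt_trans _ _ (\int[m]_x (cst 1 x))).
    apply: ge0_le_integral => //.
    - by move=> x _; rewrite lee_fin; have /andP[] := g01 (c x).
    - by move=> x _; rewrite lee_fin; have /andP[] := g01 (c x).
  by rewrite integral_cst// mul1e ltey_eq fin_num_measure.
have Isum (m : {finite_measure set T -> \bar R}) (g : nat -> R) A :
    (forall i, 0 <= g i <= 1)%R -> measurable A ->
    \int[m]_x ((g (c x))%:E * (\1_A x)%:E) +
    \int[m]_x (((1 - g (c x)))%:E * (\1_A x)%:E) = m A.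
  move=> g01 mA; rewrite -ge0_integralD//; first last.
  - by apply: emeasurable_funM; [exact: (mcomp (fun i => 1 - g i)%R)|exact: mI].
  - by move=> x _; rewrite mule_ge0// lee_fin// subr_ge0; have /andP[] := g01 (c x).
  - by apply: emeasurable_funM; [exact: mcomp|exact: mI].
  - by move=> x _; rewrite mule_ge0// lee_fin//; have /andP[] := g01 (c x).
  transitivity (\int[m]_x (\1_A x)%:E); last by rewrite integral_indic// setIT.
  by apply: eq_integral => x _; rewrite -!EFinM -EFinD; congr (_%:E); ring.
have Icell (m : {finite_measure set T -> \bar R}) (g : nat -> R) i : (0 <= g i)%R ->
    \int[m]_x ((g (c x))%:E * (\1_(F i) x)%:E) = (g i)%:E * m (F i).
  move=> g0.
  have -> : m (F i) = \int[m]_x (\1_(F i) x)%:E by rewrite integral_indic// setIT.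
  rewrite -ge0_integralZl//; last exact: mI.
  apply: eq_integral => x _; rewrite indicE.
  by have [/set_mem <-//|] := boolP (x \in F i); rewrite !mule0.
have fb01 i : (0 <= f i * b i <= 1)%R by rewrite fb1 mulr_ge0.
have fa01 i : (0 <= f i * a i <= 1)%R by rewrite fa1 mulr_ge0.
have c01 (g : nat -> R) : (forall i, 0 <= g i <= 1)%R -> (forall i, 0 <= 1 - g i <= 1)%R.
  by move=> h i; have /andP[? ?] := h i; rewrite subr_ge0 gerBl; apply/andP.
have [xi xiE] : exists xi : {finite_measure set (T * T)%type -> \bar R},
    forall A, measurable A -> xi A = \int[mu \x nu]_z (w z * (\1_A z)%:E).
  apply: finite_density_measure => //.
  have -> : \int[mu \x nu]_z w z = \int[mu]_x ((f (c x) * b (c x))%:E * (\1_setT x)%:E).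
    rewrite -w1//; apply: eq_integral => z _.
    by rewrite indicE in_setX !in_setT mule1.
  rewrite (@le_lt_trans _ _ (mu setT)) ?ltey_eq ?fin_num_measure//.
  rewrite -(Isum mu (fun i => f i * b i)%R setT)//.
  rewrite leeDl// integral_ge0// => x _; rewrite mule_ge0 ?lee_fin//.
  by have /andP[] := c01 _ fb01 (c x).
have [mu' mu'E] := Iden mu _ (c01 _ fb01).
have [nu' nu'E] := Iden nu _ (c01 _ fa01).
exists xi, mu', nu'; split.
- move=> A mA; rewrite xiE ?mu'E ?w1//; last exact: measurableX.
  exact: (Isum mu (fun i => f i * b i)%R).
- move=> A mA; rewrite xiE ?nu'E ?w2//; last exact: measurableX.
  exact: (Isum nu (fun i => f i * a i)%R).
- move=> i; rewrite -/(F i) mu'E ?nu'E//.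
  rewrite (Icell mu (fun i => 1 - f i * b i)%R) ?subr_ge0//.
  rewrite (Icell nu (fun i => 1 - f i * a i)%R) ?subr_ge0//.
  rewrite aE bE -!EFinM -EFinD -EFinB/=; congr (_%:E).
  have -> : ((1 - f i * b i) * a i + (1 - f i * a i) * b i =
    a i + b i - (f i * (a i * b i)) *+ 2)%R by ring.
  rewrite fab; case: (leP (a i) (b i)) => h.
    by rewrite ler0_norm ?subr_le0//; ring.
  by rewrite gtr0_norm ?subr_gt0//; ring.
- have -> : [set z : (T * T)%type | c z.1 <> c z.2] = ~` D by [].
  rewrite xiE; last exact: measurableC.
  apply: integral0_eq => z _; rewrite /w !indicE in_setC.
  by case: (z \in D); rewrite ?mule0 ?mul0e.
Qed.

End coupling_step.

Section hierarchical_coupling.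
Local Open Scope ereal_scope.
Context d (T : measurableType d) (R : realType).
Implicit Types mu nu : {finite_measure set T -> \bar R}.

(** The measure of density 1 carries the structure of finite measure that is
    needed to iterate [coupling_step]. *)
Lemma finite_measure_of d' (U : measurableType d') (m : {measure set U -> \bar R}) :
  m setT < +oo ->
  exists m' : {finite_measure set U -> \bar R},
    forall A, measurable A -> m' A = m A.
Proof.
move=> mfin; have [|||m' m'E] := @finite_density_measure _ U R m (cst 1) => //.
  by rewrite integral_cst// mul1e.
exists m' => A mA; rewrite m'E//.
transitivity (\int[m]_x (\1_A x)%:E); last by rewrite integral_indic// setIT.
by apply: eq_integral => x _; rewrite mul1e.
Qed.

Lemma integral_marginal d' (U : measurableType d') (phi : U -> T)
    (xi : {measure set U -> \bar R}) (mu' mu : {measure set T -> \bar R})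
    (g : T -> \bar R) :
  measurable_fun setT phi ->
  (forall A, measurable A -> xi (phi @^-1` A) + mu' A = mu A) ->
  measurable_fun setT g -> (forall x, 0 <= g x) ->
  \int[mu]_x g x = \int[xi]_z g (phi z) + \int[mu']_x g x.
Proof.
move=> mphi muE mg g0.
unshelve epose (m := (pushforward xi phi : {measure set T -> \bar R})) => //.
have -> : \int[xi]_z g (phi z) = \int[m]_x g x.
  by rewrite [RHS]ge0_integral_pushforward.
rewrite -ge0_integral_measure_add//.
by apply: eq_measure_integral => A mA _; rewrite -muE//; exact/esym/measure_addE.
Qed.

Lemma measurable_neq_cells (c : T -> nat) : measurable_fun setT c ->
measurable [set z : (T * T)%type | c z.1 <> c z.2].
Proof.
move=> mc.
have -> : [set z : (T * T)%type | c z.1 <> c z.2] =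
    (fun z : (T * T)%type => c z.1 == c z.2) @^-1` [set false].
  apply/seteqP; split => z /=; first by move/eqP/negbTE.
  by move/negbT/eqP.
rewrite -[X in measurable X]setTI.
have : measurable_fun setT (fun z : (T * T)%type => c z.1 == c z.2).
  by apply: measurable_fun_eqn; exact: measurableT_comp.
exact.
Qed.

(** As [xi] lives on the pairs that share a cell, the cost splits into a
    function of [x] and one of [y], which only see the marginals of [xi]. *)
Lemma cost_on_diagonal (xi : {finite_measure set (T * T)%type -> \bar R})
    (mu mu' nu nu' : {finite_measure set T -> \bar R}) (c : T -> nat)
    (f : T * T -> \bar R) (g : T -> \bar R) :
  measurable_fun setT c ->
  (forall A, measurable A -> xi (A `*` setT) + mu' A = mu A) ->
  (forall A, measurable A -> xi (setT `*` A) + nu' A = nu A) ->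
  xi [set z | c z.1 <> c z.2] = 0 ->
  measurable_fun setT f -> (forall z, 0 <= f z) ->
  measurable_fun setT g -> (forall x, 0 <= g x) ->
  (forall x y, c x = c y -> f (x, y) <= g x + g y) ->
  \int[xi]_z f z <= \int[mu]_x g x + \int[nu]_y g y.
Proof.
move=> mc xi1 xi2 xi0 mf f0 mg g0 fg.
have mg1 : measurable_fun setT (fun z : T * T => g z.1) by exact: measurableT_comp.
have mg2 : measurable_fun setT (fun z : T * T => g z.2) by exact: measurableT_comp.
have mD := measurable_neq_cells mc.
apply: (@le_trans _ _ (\int[xi]_z (g z.1 + g z.2))).
  apply: ae_ge0_le_integral => //.
  - by move=> z _; rewrite adde_ge0.
  - exact: emeasurable_funD.
  exists [set z | c z.1 <> c z.2]; split => // -[x y] /= h e.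
  by apply: h => _; exact: fg.
rewrite ge0_integralD//; apply: leeD.
- rewrite (integral_marginal (phi := fst) (xi := xi) (mu' := mu') (mu := mu))//.
    by rewrite leeDl// integral_ge0.
  move=> A mA; rewrite -[RHS]xi1//; congr (xi _ + _).
  by apply/seteqP; split => z //= -[].
- rewrite (integral_marginal (phi := snd) (xi := xi) (mu' := nu') (mu := nu))//.
    by rewrite leeDl// integral_ge0.
  move=> A mA; rewrite -[RHS]xi2//; congr (xi _ + _).
  by apply/seteqP; split => z //= -[].
Qed.

(** Level 0 is the trivial partition and the partitions get finer.  The mass
    coupled at level L.+1 stays inside cells, hence does not change
    mu F - nu F for the coarser cells F; so the remainders of that step have
    total mass |mu F - nu F| on each cell F of level L.+1.  They are coupled by
    induction at the levels up to L, at a cost that is at most [g L] summed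
    over both remainders: this is the charge that [B L] controls. *)
Lemma hierarchical_coupling (c : nat -> T -> nat) (f : T * T -> \bar R)
    (g : nat -> T -> \bar R) (B : nat -> \bar R) :
  (forall k, measurable_fun setT (c k)) ->
  (forall x y, c 0%N x = c 0%N y) ->
  (forall k x y, c k.+1 x = c k.+1 y -> c k x = c k y) ->
  measurable_fun setT f -> (forall z, 0 <= f z) ->
  (forall k, measurable_fun setT (g k)) -> (forall k x, 0 <= g k x) ->
  (forall k x y, c k x = c k y -> f (x, y) <= g k x + g k y) ->
  forall L mu nu, mu setT = nu setT ->
  (forall k (m1 m2 : {finite_measure set T -> \bar R}), (k < L)%N ->
     (forall i, m1 (c k.+1 @^-1` [set i]) + m2 (c k.+1 @^-1` [set i]) =
       `|mu (c k.+1 @^-1` [set i]) - nu (c k.+1 @^-1` [set i])|) ->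
     \int[m1]_x g k x + \int[m2]_x g k x <= B k) ->
  exists xi : {finite_measure set (T * T)%type -> \bar R},
    [/\ forall A, measurable A -> xi (A `*` setT) = mu A,
        forall A, measurable A -> xi (setT `*` A) = nu A &
        \int[xi]_z f z <= \sum_(k < L) B k +
                         (\int[mu]_x g L x + \int[nu]_x g L x)].
Proof.
move=> mc c0 nest mf f0 mg g0 fg; elim => [|L IH] mu nu munu Bbd.
  have [xi [mu' [nu' [xi1 xi2 res xi0]]]] := coupling_step mu nu (mc 0%N).
  have cT : c 0%N @^-1` [set c 0%N point] = setT.
    by apply/seteqP; split => x //= _; exact: c0.
  have := res (c 0%N point).
  have -> : mu (c 0%N @^-1` [set c 0%N point]) - nu (c 0%N @^-1` [set c 0%N point]) = 0.
    by rewrite cT munu subee// fin_num_measure.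
  rewrite cT abse0 => /eqP; rewrite padde_eq0// => /andP[/eqP mu'0 /eqP nu'0].
  exists xi; split.
  - move=> A mA; rewrite -xi1// (_ : mu' A = 0) ?adde0//.
    exact: (subset_measure0 mA _ _ mu'0).
  - move=> A mA; rewrite -xi2// (_ : nu' A = 0) ?adde0//.
    exact: (subset_measure0 mA _ _ nu'0).
  - by rewrite big_ord0 add0e; exact: (cost_on_diagonal (mc 0%N) xi1 xi2 xi0 mf f0 (mg 0%N) (g0 0%N) (fg 0%N)).
have [xi [mu' [nu' [xi1 xi2 res xi0]]]] := coupling_step mu nu (mc L.+1).
have mF k i : measurable (c k @^-1` [set i]).
  by rewrite -[X in measurable X]setTI; exact: mc.
have coarse k : (k <= L.+1)%N -> forall x y, c L.+1 x = c L.+1 y -> c k x = c k y.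
  move=> /subnK <-; elim: (L.+1 - k)%N => [//|n IHn] x y.
  by rewrite addSn => /nest/IHn.
have xiD A B' : measurable A -> measurable B' ->
    (forall z, c L.+1 z.1 = c L.+1 z.2 -> A z <-> B' z) -> xi A = xi B'.
  have sub (A1 A2 : set (T * T)%type) : measurable A1 -> measurable A2 ->
      (forall z, c L.+1 z.1 = c L.+1 z.2 -> A1 z -> A2 z) -> xi A1 <= xi A2.
    move=> mA1 mA2 A12; rewrite -(measureU0 mA2 (measurable_neq_cells (mc L.+1)) xi0).
    apply: le_measure; rewrite ?inE//.
      by apply: measurableU => //; exact: measurable_neq_cells.
    move=> z A1z; have [e|ne] := pselect (c L.+1 z.1 = c L.+1 z.2).
      by left; exact: A12.
    by right.
  by move=> mA mB AB; apply/eqP; rewrite eq_le !sub// => z /AB[].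
have diff A : measurable A -> xi (A `*` setT) = xi (setT `*` A) ->
    mu A - nu A = mu' A - nu' A.
  move=> mA e; rewrite -xi1// -xi2// e.
  have hx : xi (setT `*` A) \is a fin_num.
    by rewrite fin_num_measure//; exact: measurableX.
  have hm : mu' A \is a fin_num by rewrite fin_num_measure.
  have hn : nu' A \is a fin_num by rewrite fin_num_measure.
  rewrite -(fineK hx) -(fineK hm) -(fineK hn) -!EFinD.
  by congr (_%:E); ring.
have diffk k i : (k <= L.+1)%N -> mu (c k @^-1` [set i]) - nu (c k @^-1` [set i]) =
    mu' (c k @^-1` [set i]) - nu' (c k @^-1` [set i]).
  move=> kL; apply: diff => //; apply: xiD; [exact: measurableX..|].
  move=> [x y] /= e; have {}e := coarse _ kL _ _ e.
  by split => -[/= h1 h2]; split => //=; [rewrite -e|rewrite e].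
have munu' : mu' setT = nu' setT.
  rewrite -[LHS](@subeK _ _ (nu' setT)) ?fin_num_measure// -diff//.
  by rewrite munu subee ?fin_num_measure// add0e.
have [k m1 m2 kL e|xi' [xi'1 xi'2 cost']] := IH mu' nu' munu'.
  by apply: Bbd; [exact: ltnW|move=> i; rewrite e diffk// ltnW].
have [|s sE] := finite_measure_of (m := measure_add xi xi').
  by rewrite [ltLHS]measure_addE ltey_eq fin_numD !fin_num_measure.
exists s; split.
- move=> A mA; rewrite sE; last exact: measurableX.
  by rewrite [LHS]measure_addE -xi1//; congr (_ + _); exact: xi'1.
- move=> A mA; rewrite sE; last exact: measurableX.
  by rewrite [LHS]measure_addE -xi2//; congr (_ + _); exact: xi'2.
have -> : \int[s]_z f z = \int[measure_add xi xi']_z f z.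
  by apply: eq_measure_integral => A mA _; exact: sE.
rewrite ge0_integral_measure_add//.
have h1 := cost_on_diagonal (mc L.+1) xi1 xi2 xi0 mf f0 (mg L.+1) (g0 L.+1) (fg L.+1).
have h2 : \int[mu']_x g L x + \int[nu']_x g L x <= B L by apply: Bbd.
rewrite addeC big_ord_recr/=; apply: leeD => //.
by apply: (le_trans cost'); exact: leeD.
Qed.

End hierarchical_coupling.

(** * Dyadic shells and cubes *)

Section discrete_measurability.
Context d (T : measurableType d) (R : realType).

Lemma measurable_fun_pickle (I : countType) (c : T -> I) :
  (forall i, measurable (c @^-1` [set i])) ->
  measurable_fun setT (fun x => pickle (c x)).
Proof.
move=> mc _ Y _; rewrite setTI.
have -> : (fun x => pickle (c x)) @^-1` Y =
    \bigcup_(n in Y) (fun x => pickle (c x)) @^-1` [set n].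
  apply/seteqP; split => x /=; first by move=> Yx; exists (pickle (c x)).
  by move=> [n Yn ->].
apply: bigcup_measurable => n Yn.
case e : (unpickle n : option I) => [i|]; last first.
  rewrite (_ : _ @^-1` _ = set0)//; apply/seteqP; split => x //= h.
  by rewrite -h pickleK in e.
have [ei|ne] := eqVneq (pickle i) n.
  rewrite (_ : _ @^-1` _ = c @^-1` [set i])//; apply/seteqP; split => x /=.
    by rewrite -ei => /(pcan_inj pickleK).
  by move=> ->.
rewrite (_ : _ @^-1` _ = set0)//; apply/seteqP; split => x //= h.
by move/eqP: ne; apply; rewrite -h pickleK in e; case: e => <-.
Qed.

Lemma measurable_fun_nat_le (f : T -> nat) :
  (forall n, measurable [set x | (f x <= n)%N]) -> measurable_fun setT f.
Proof.
move=> mf _ Y _; rewrite setTI.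
have -> : f @^-1` Y = \bigcup_(n in Y) (f @^-1` [set n]).
  apply/seteqP; split => x /=; first by move=> Yx; exists (f x).
  by move=> [n Yn ->].
apply: bigcup_measurable => -[|n] Yn.
  rewrite (_ : _ @^-1` _ = [set x | (f x <= 0)%N])//.
  by apply/seteqP; split => x /=; [move=> ->|rewrite leqn0 => /eqP].
rewrite (_ : _ @^-1` _ = [set x | (f x <= n.+1)%N] `\` [set x | (f x <= n)%N]).
  exact: measurableD.
apply/seteqP; split => x /=; first by move=> ->; rewrite ltnn.
move=> [h1 /negP]; rewrite -ltnNge => h2; apply/eqP.
by rewrite eqn_leq h1.
Qed.

Lemma measurable_fun_truncn (f : T -> R) : measurable_fun setT f ->
  measurable_fun setT (fun x => Num.truncn (f x)).
Proof.
move=> mf; apply: measurable_fun_nat_le => n.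
rewrite (_ : [set _ | _] = f @^-1` `]-oo, n.+1%:R[).
  by rewrite -[X in measurable X]setTI; exact: mf.
by apply/seteqP; split => x /=; rewrite in_itv/= truncn_le_nat.
Qed.

End discrete_measurability.

Section dyadic_cells.
Context {R : realType} {d : nat}.
Implicit Types (x y : d.-tuple R) (n k : nat).

Lemma enorm_ge0 x : 0 <= enorm x. Proof. exact: sqrtr_ge0. Qed.

Lemma coord_le_enorm x i : `|tnth x i| <= enorm x.
Proof.
rewrite /enorm -sqrtr_sqr ler_sqrt ?sumr_ge0// => [|j _]; last exact: sqr_ge0.
by rewrite (bigD1 i)//= lerDl sumr_ge0// => j _; exact: sqr_ge0.
Qed.

Lemma enorm_le x (e : R) : 0 <= e -> (forall i, `|tnth x i| <= e) ->
  enorm x <= Num.sqrt d%:R * e.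
Proof.
move=> e0 xe; rewrite -[e in leRHS]ger0_norm// -sqrtr_sqr -sqrtrM ?ler0n//.
rewrite ler_sqrt ?mulr_ge0 ?sqr_ge0 ?ler0n//.
rewrite (@le_trans _ _ (\sum_(i < d) e ^+ 2))//; last first.
  by rewrite sumr_const card_ord mulr_natl.
by apply: ler_sum => i _; rewrite -(ger0_norm (sqr_ge0 (tnth x i))) normrX lerXn2r ?nnegrE.
Qed.

(** Shell 0 is the open unit ball; shell n > 0 is 2^(n-1) <= |x| < 2^n. *)
Definition shell x := up_log 2 (Num.truncn (enorm x)).+1.

Lemma enorm_lt_shell x : enorm x < 2 ^+ shell x.
Proof.
have h := up_logP (Num.truncn (enorm x)).+1 (isT : (1 < 2)%N).
apply: (lt_le_trans (truncnS_gt _)).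
by rewrite -natrX ler_nat.
Qed.

Lemma enorm_ge_shell x : (0 < shell x)%N -> 2 ^+ (shell x).-1 <= enorm x.
Proof.
rewrite /shell up_log_gt0/= => t1.
have := up_log_gtn (isT : (1 < 2)%N) t1.
rewrite ltnS => h; rewrite -natrX -truncn_ge_nat//; exact: enorm_ge0.
Qed.

(** The rescaled coordinate lies in (0, 2^(k+1)), whatever the shell, so that
    its integer part is a digit of the cube of level [k]. *)
Definition coord k x i : R := (tnth x i / 2 ^+ shell x + 1) * 2 ^+ k.

(** The bound of the ordinals is never reached ([coord_trunc]), so that [inord]
    loses nothing.  In shell n the cube has side 2^(n-k). *)
Definition cube k x : {ffun 'I_d -> 'I_(2 ^ k.+1).+1} :=
  [ffun i => inord (Num.truncn (coord k x i))].

Lemma coord_ge0 k x i : 0 <= coord k x i.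
Proof.
rewrite mulr_ge0 ?exprn_ge0// -lerBlDr sub0r ler_pdivlMr ?exprn_gt0// mulN1r.
rewrite lerNl; apply: le_trans (ltW (enorm_lt_shell x)).
by apply: le_trans (coord_le_enorm x i); rewrite -normrN ler_norm.
Qed.

Lemma coord_trunc k x i : (Num.truncn (coord k x i) < (2 ^ k.+1).+1)%N.
Proof.
rewrite truncn_lt_nat ?coord_ge0// (@le_lt_trans _ _ (2 ^ k.+1)%:R) ?ltr_nat//.
rewrite natrX exprS ler_pM2r ?exprn_gt0// (_ : 2 = 1 + 1)// lerD2r.
rewrite ler_pdivrMr ?exprn_gt0// mul1r; apply: le_trans (ltW (enorm_lt_shell x)).
by apply: le_trans (coord_le_enorm x i); exact: ler_norm.
Qed.

Lemma cube_trunc k x y i : cube k x = cube k y ->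
  Num.truncn (coord k x i) = Num.truncn (coord k y i).
Proof.
move=> /ffunP/(_ i); rewrite !ffunE => /(congr1 val).
by rewrite /= !inordK ?coord_trunc.
Qed.

(** The digit at level [k] is the half of the digit at level [k.+1]; this makes
    the cubes nested. *)
Lemma truncn_half (t : R) : 0 <= t -> Num.truncn t = (Num.truncn (t * 2))./2.
Proof.
move=> t0; apply: truncn_def.
have t20 : 0 <= t * 2 by rewrite mulr_ge0.
have /andP[h1 h2] := truncn_itv t20.
set m := Num.truncn _ in h1 h2 *.
have mE := odd_double_half m.
have : (m <= (m./2).*2.+1)%N by rewrite -[leqLHS]mE; case: odd; rewrite ?add1n ?add0n.
have : ((m./2).*2 <= m)%N by rewrite -[leqRHS]mE leq_addl.
rewrite -!(ler_nat R) -muln2 -!natr1 !natrM => e1 e2; apply/andP.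
by move: h2; rewrite -!natr1 => h2; split; lra.
Qed.

Lemma cube_nested k x y : cube k.+1 x = cube k.+1 y -> cube k x = cube k y.
Proof.
move=> e; apply/ffunP => i; rewrite !ffunE; congr inord.
rewrite !(truncn_half (coord_ge0 _ _ _)); congr _./2.
have := cube_trunc i e; rewrite /coord !exprSr !mulrA.
by [].
Qed.

Lemma cube_close k x y i : shell x = shell y -> cube k x = cube k y ->
  `|tnth x i - tnth y i| <= 2 ^+ shell x / 2 ^+ k.
Proof.
move=> exy /(cube_trunc i) e.
have /andP[x1 x2] := truncn_itv (coord_ge0 k x i).
have /andP[y1 y2] := truncn_itv (coord_ge0 k y i).
have : `|coord k x i - coord k y i| <= 1.
  move: x1 x2 y1 y2; rewrite e -!natr1 => x1 x2 y1 y2.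
  by rewrite ler_norml; apply/andP; split; lra.
have sp : (0 : R) < 2 ^+ shell x by rewrite exprn_gt0.
have kp : (0 : R) < 2 ^+ k by rewrite exprn_gt0.
have -> : coord k x i - coord k y i =
    (tnth x i - tnth y i) * (2 ^+ k / 2 ^+ shell x).
  by rewrite /coord -exy; field; rewrite gt_eqF.
rewrite normrM (gtr0_norm (divr_gt0 kp sp)) => h.
by rewrite -ler_pdivlMr ?divr_gt0// in h; rewrite (le_trans h)// invf_div mul1r.
Qed.

Lemma measurable_enorm : measurable_fun [set: d.-tuple R] enorm.
Proof.
have -> : enorm = @Num.sqrt R \o (fun x : d.-tuple R => \sum_(i < d) tnth x i ^+ 2) by [].
apply: measurableT_comp.
  by apply: continuous_measurable_fun; exact: sqrt_continuous.
apply: measurable_sum => i; apply: measurable_funX; exact: measurable_tnth.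
Qed.

Lemma measurable_shell : measurable_fun [set: d.-tuple R] shell.
Proof.
have -> : shell = (fun n : nat => up_log 2 n.+1) \o (fun x => Num.truncn (enorm x)) by [].
apply: measurableT_comp => //.
by apply: measurable_fun_truncn; exact: measurable_enorm.
Qed.

Lemma measurable_coord k i : measurable_fun [set: d.-tuple R] (coord k ^~ i).
Proof.
apply: measurable_funM; last exact: measurable_cst.
apply: measurable_funD; last exact: measurable_cst.
apply: measurable_funM; first exact: measurable_tnth.
exact: (measurableT_comp (f := fun n : nat => (2 ^+ n)^-1 : R) _ measurable_shell).
Qed.

Lemma measurable_cell k n (j : {ffun 'I_d -> 'I_(2 ^ k.+1).+1}) :
  measurable [set x | shell x = n /\ cube k x = j].
Proof.
have -> : [set x | shell x = n /\ cube k x = j] = shell @^-1` [set n] `&`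
    \bigcap_(i in [set: 'I_d]) (fun x => Num.truncn (coord k x i)) @^-1` [set m | inord m = j i].
  apply/seteqP; split => x /= [h1 h2]; split => //.
    by move=> i _ /=; rewrite -h2 ffunE.
  by apply/ffunP => i; rewrite ffunE; exact: h2.
apply: measurableI.
  by rewrite -[X in measurable X]setTI; exact: measurable_shell.
apply: fin_bigcap_measurable => // i _; rewrite -[X in measurable X]setTI.
by apply: measurable_fun_truncn => //; exact: measurable_coord.
Qed.

Lemma measurable_shell_fiber n : measurable [set x | shell x = n].
Proof. by rewrite -[X in measurable X]setTI; exact: (measurable_shell measurableT (Y := [set n])). Qed.

Lemma measurable_enorm_subt :
  measurable_fun [set: (d.-tuple R * d.-tuple R)%type] (fun z => enorm (subt z.1 z.2)).
Proof.
apply: (measurableT_comp measurable_enorm).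
apply/measurable_fun_tnthP => i.
rewrite [X in measurable_fun _ X](_ : _ = fun z => tnth z.1 i - tnth z.2 i); last first.
  by apply/funext => z /=; rewrite tnth_mktuple.
by apply: measurable_funB; apply: (measurableT_comp (measurable_tnth i)).
Qed.

End dyadic_cells.

(** * Multiscale bound of the transport cost *)

Section probability_of_measure.
Local Open Scope ereal_scope.
Context d (T : measurableType d) (R : realType).

Lemma probability_of (m : {measure set T -> \bar R}) : m setT = 1 ->
  exists P : probability T R, forall A, P A = m A.
Proof.
move=> m1; pose m0 (A : set T) := m A.
pose M := isMeasure.Build d T R m0 (measure0 m) (measure_ge0 m)
  (@measure_semi_sigma_additive _ _ _ m).
pose m1' : {measure set T -> \bar R} := HB.pack m0 M.
pose F := Measure_isProbability.Build d T R m1' m1.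
pose P : probability T R := HB.pack m0 M F.
by exists P.
Qed.

End probability_of_measure.

Section transport_bound.
Context {R : realType} {d : nat}.
Notation T := (d.-tuple R).
Variable p : R.
Hypothesis p0 : 0 <= p.

Definition cell (k n : nat) (j : {ffun 'I_d -> 'I_(2 ^ k.+1).+1}) : set T :=
  [set x | shell x = n /\ cube k x = j].

Definition shell_set (n : nat) : set T := [set x | shell x = n].

(** Level 0 of the coupling is the whole space and level [k.+1] is made of the
    cubes [cube k]; the factor 2 in the constant absorbs this shift as well as
    the distance between two points of different shells. *)
Definition level_cost (k n : nat) : R :=
  (2 * Num.sqrt d%:R) `^ p * 2 `^ (p * (n%:R - k%:R)).

Lemma level_cost_ge0 k n : 0 <= level_cost k n.
Proof. by rewrite mulr_ge0 ?powR_ge0. Qed.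

Lemma cost_top (x y : T) : enorm (subt x y) `^ p <=
  level_cost 0 (shell x) + level_cost 0 (shell y).
Proof.
wlog xy : x y / (shell y <= shell x)%N.
  move=> h; have [|/ltnW] := leqP (shell y) (shell x); first exact: h.
  move=> /h; rewrite addrC; apply: le_trans; rewrite le_eqVlt; apply/orP; left.
  apply/eqP; congr powR; congr Num.sqrt; apply: eq_bigr => i _.
  by rewrite !tnth_mktuple -sqrrN opprB.
apply: (@le_trans _ _ (level_cost 0 (shell x))); last by rewrite lerDl level_cost_ge0.
have -> : level_cost 0 (shell x) = ((2 * Num.sqrt d%:R) * 2 ^+ shell x) `^ p.
  rewrite [RHS]powRM ?mulr_ge0 ?sqrtr_ge0 ?exprn_ge0// /level_cost subr0.
  by congr (_ * _); rewrite mulrC powRrM powR_mulrn.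
apply: ge0_ler_powR => //; rewrite ?nnegrE ?mulr_ge0 ?sqrtr_ge0 ?exprn_ge0//.
rewrite (mulrC 2) -mulrA; apply: enorm_le; first by rewrite mulr_ge0// exprn_ge0.
move=> i; rewrite tnth_mktuple (le_trans (ler_normB _ _))// mulr_natl mulr2n lerD//.
  exact: (le_trans (coord_le_enorm _ _) (ltW (enorm_lt_shell _))).
apply: (le_trans (coord_le_enorm _ _) (le_trans (ltW (enorm_lt_shell _)) _)).
by rewrite ler_eXn2l// ltr1n.
Qed.

Lemma cost_cell k (x y : T) : shell x = shell y -> cube k x = cube k y ->
  enorm (subt x y) `^ p <= level_cost k.+1 (shell x).
Proof.
move=> sxy cxy.
have -> : level_cost k.+1 (shell x) = (Num.sqrt d%:R * (2 ^+ shell x / 2 ^+ k)) `^ p.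
  have -> : Num.sqrt d%:R * (2 ^+ shell x / 2 ^+ k) =
      (2 * Num.sqrt d%:R) * (2 `^ ((shell x)%:R - k.+1%:R)) :> R.
    rewrite powRB ?implybT//; last by rewrite pnatr_eq0 implybT.
    rewrite !powR_mulrn// exprS.
    by field; rewrite expf_eq0 pnatr_eq0 andbF.
  rewrite [RHS]powRM ?mulr_ge0 ?sqrtr_ge0 ?powR_ge0//.
  by rewrite /level_cost (mulrC p) powRrM.
apply: ge0_ler_powR => //; rewrite ?nnegrE ?mulr_ge0 ?sqrtr_ge0 ?invr_ge0 ?exprn_ge0//.
apply: enorm_le; first by rewrite divr_ge0// exprn_ge0.
by move=> i; rewrite tnth_mktuple; exact: cube_close.
Qed.

Local Open Scope ereal_scope.

Lemma shell_set_cells k n (m : {measure set T -> \bar R}) :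
  m (shell_set n) = \sum_(j : {ffun 'I_d -> 'I_(2 ^ k.+1).+1}) m (cell n j).
Proof.
have -> : shell_set n =
    \bigcup_(j in [set: {ffun 'I_d -> 'I_(2 ^ k.+1).+1}]) cell n j.
  by apply/seteqP; split => x; [move=> xn; exists (cube k x)|move=> [j _ []]].
rewrite measure_fin_bigcup//.
- rewrite -[RHS]big_enum/= [RHS]fsbig_seq ?enum_uniq//.
  by apply: eq_fsbigl; apply/seteqP; split => j //= _; rewrite mem_enum.
- exact: finite_finset.
- by apply/trivIsetP => i j _ _ ij; apply/seteqP; split => x // -[[_ xi] [_ xj]];
    move: ij; rewrite -xi -xj eqxx.
- by move=> j _; exact: measurable_cell.
Qed.

Lemma integral_shell (a : nat -> R) (m : {measure set T -> \bar R}) :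
  (forall n, (0 <= a n)%R) ->
  \int[m]_x (a (shell x))%:E = \sum_(n <oo) (a n)%:E * m (shell_set n).
Proof.
move=> a0.
have -> : \int[m]_x (a (shell x))%:E =
   \int[m]_(x in \bigcup_n shell_set n) (a (shell x))%:E.
  by congr integral; apply/seteqP; split => x // _; exists (shell x).
have ma : measurable_fun setT (fun x : T => (a (shell x))%:E).
  by apply/measurable_EFinP; apply: (measurableT_comp (f := a)) => //; exact: measurable_shell.
rewrite ge0_integral_bigcup//.
- apply: eq_eseriesr => n _.
  transitivity (\int[m]_(x in shell_set n) (cst (a n)%:E) x).
    by apply: eq_integral => x /set_mem <-.
  by rewrite integral_cst//; exact: measurable_shell_fiber.
- by move=> n; exact: measurable_shell_fiber.
- exact: measurable_funTS.
- by move=> x _; rewrite lee_fin.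
- by apply/trivIsetP => i j _ _ ij; apply/seteqP; split => x // -[/= xi xj];
    move: ij; rewrite -xi -xj eqxx.
Qed.

(** [hierarchical_coupling] for the partitions by [cube k].  The remainders are
    measured on the cells of level [k.+1] and pay the diameter of level [k]. *)
Lemma transport_le_multiscale (mu nu : {measure set T -> \bar R}) (L : nat) :
  mu setT = 1 -> nu setT = 1 ->
  transport p mu nu <=
    \sum_(k < L) \sum_(n <oo) (level_cost k n)%:E *
      (\sum_(j : {ffun 'I_d -> 'I_(2 ^ k.+1).+1}) `|mu (cell n j) - nu (cell n j)|) +
    \sum_(n <oo) (level_cost L n)%:E * (mu (shell_set n) + nu (shell_set n)).
Proof.
move=> mu1 nu1.
have [|mu' mu'E] := finite_measure_of (m := mu); first by rewrite mu1 ltry.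
have [|nu' nu'E] := finite_measure_of (m := nu); first by rewrite nu1 ltry.
pose c k : T -> nat := if k is k'.+1 then fun x => pickle (shell x, cube k' x) else cst 0%N.
pose f (z : T * T) : \bar R := (enorm (subt z.1 z.2) `^ p)%:E.
pose g k (x : T) : \bar R := (level_cost k (shell x))%:E.
pose B k := \sum_(n <oo) (level_cost k n)%:E *
  (\sum_(j : {ffun 'I_d -> 'I_(2 ^ k.+1).+1}) `|mu (cell n j) - nu (cell n j)|).
have mcell k n j : measurable (@cell k n j) by exact: measurable_cell.
have cellE k n (j : {ffun 'I_d -> 'I_(2 ^ k.+1).+1}) :
    cell n j = c k.+1 @^-1` [set pickle (n, j)].
  apply/seteqP; split => x; rewrite /cell/=; first by move=> [-> ->].
  by move=> /(pcan_inj pickleK)[-> ->].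
have mc k : measurable_fun setT (c k).
  case: k => [|k]; first exact: measurable_cst.
  apply: measurable_fun_pickle => -[n j].
  rewrite [X in measurable X](_ : _ = cell n j); first exact: mcell.
  by apply/seteqP; split => x; rewrite /cell/= => -[-> ->].
have mg k : measurable_fun setT (g k).
  apply/measurable_EFinP; apply: (measurableT_comp (f := level_cost k)) => //.
  exact: measurable_shell.
have g0 k x : 0 <= g k x by rewrite lee_fin level_cost_ge0.
have mf : measurable_fun setT f.
  apply/measurable_EFinP; apply: (measurableT_comp (f := fun t : R => t `^ p)%R) => //.
  exact: measurable_enorm_subt.
have f0 z : 0 <= f z by rewrite lee_fin powR_ge0.
have fg k x y : c k x = c k y -> f (x, y) <= g k x + g k y.
  case: k => [_|k /(pcan_inj pickleK)[e1 e2]]; rewrite -EFinD lee_fin.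
    exact: cost_top.
  by rewrite (le_trans (cost_cell e1 e2))// lerDl level_cost_ge0.
have nest k x y : c k.+1 x = c k.+1 y -> c k x = c k y.
  case: k => [//|k] /(pcan_inj pickleK)[e1 e2] /=.
  by rewrite e1 (cube_nested e2).
have munu' : mu' setT = nu' setT by rewrite mu'E// nu'E// mu1 nu1.
have [|xi [xi1 xi2 cost]] := hierarchical_coupling mc (fun _ _ => erefl) nest mf f0 mg g0 fg
  (L := L) (B := B) munu'.
  move=> k m1 m2 _ e; rewrite !integral_shell; [|exact: level_cost_ge0..].
  rewrite -nneseriesD; last 2 first.
  - by move=> n _; rewrite mule_ge0// lee_fin level_cost_ge0.
  - by move=> n _; rewrite mule_ge0// lee_fin level_cost_ge0.
  apply: lee_nneseries => [n _|n _].
    by rewrite adde_ge0// mule_ge0// lee_fin level_cost_ge0.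
  rewrite -ge0_muleDr// !(shell_set_cells k) -big_split/=.
  rewrite le_eqVlt; apply/orP; left; apply/eqP; congr (_ * _).
  apply: eq_bigr => j _; rewrite cellE e.
  by rewrite -!cellE mu'E// nu'E.
have [P PE] : exists P : probability (T * T)%type R, forall A, P A = xi A.
  by apply: probability_of; rewrite -setXTT; apply: (etrans (xi1 _ measurableT)); rewrite mu'E.
apply: (@le_trans _ _ (\int[P]_z f z)).
  apply: ereal_inf_lbound; exists P => // A mA.
  by rewrite !PE; split; [rewrite -mu'E//; exact: xi1|rewrite -nu'E//; exact: xi2].
have -> : \int[P]_z f z = \int[xi]_z f z.
  by apply: eq_measure_integral => A mA _; exact: PE.
apply: (le_trans cost); apply: leeD => //.
rewrite !integral_shell; [|exact: level_cost_ge0..].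
rewrite -nneseriesD; last 2 first.
- by move=> n _; rewrite mule_ge0// lee_fin level_cost_ge0.
- by move=> n _; rewrite mule_ge0// lee_fin level_cost_ge0.
rewrite le_eqVlt; apply/orP; left; apply/eqP.
apply: eq_eseriesr => n _; rewrite -ge0_muleDr//; congr (_ * (_ + _)).
- by apply: mu'E; exact: measurable_shell_fiber.
- by apply: nu'E; exact: measurable_shell_fiber.
Qed.

End transport_bound.

(** * Powers of the kernel and the Markov property *)

Section kernel_powers.
Local Open Scope ereal_scope.
Context {dT : measure_display} {T : measurableType dT} {R : realType}.
Variable P : R.-pker T ~> T.
Implicit Types f : T -> \bar R.

Definition kpow (n : nat) f : T -> \bar R := fun x => \int[kernel_iter P n x]_y f y.

Lemma kpow_ge0 n f : (forall y, 0 <= f y) -> forall x, 0 <= kpow n f x.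
Proof. by move=> f0 x; exact: integral_ge0. Qed.

Lemma measurable_kpow n f : measurable_fun setT f -> (forall y, 0 <= f y) ->
  measurable_fun setT (kpow n f).
Proof.
move=> mf f0; apply: measurable_fun_integral_kernel => // U mU.
exact: measurable_kernel.
Qed.

Lemma kpow0 f : measurable_fun setT f -> (forall y, 0 <= f y) -> kpow 0 f = f.
Proof.
move=> mf f0; apply/funext => x; rewrite /kpow [LHS]integral_dirac//.
by rewrite diracT mul1e.
Qed.

Lemma measurable_dirac_kernel (A : set T) : measurable A ->
  measurable_fun setT (fun x => \d_x A : \bar R).
Proof.
move=> mA; apply/measurable_EFinP; exact: measurable_indic.
Qed.

Lemma integral_dirac_kernel (m : {measure set T -> \bar R}) f :
  measurable_fun setT f -> (forall y, 0 <= f y) ->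
  \int[m]_x \int[\d_x]_y f y = \int[m]_x f x.
Proof.
move=> mf f0; apply: eq_integral => x _.
by rewrite integral_dirac// diracT mul1e.
Qed.

Lemma integral_dirac_set (m : {measure set T -> \bar R}) (A : set T) :
  measurable A -> \int[m]_x \d_x A = m A.
Proof.
move=> mA; transitivity (\int[m]_x (\1_A x)%:E) => //.
by rewrite integral_indic// setIT.
Qed.

Lemma kpowS n f : measurable_fun setT f -> (forall y, 0 <= f y) ->
  forall x, kpow n.+1 f x = \int[P x]_y kpow n f y.
Proof.
move=> mf f0 x; rewrite /kpow -integral_dirac_kernel//.
apply: ge0_eq_integral_mixture => //.
- exact: measurable_dirac_kernel.
- by move=> A mA; exact: measurable_kernel.
- by move=> A mA; rewrite integral_dirac_set.
Qed.

Lemma integral_kpow (pi : {measure set T -> \bar R}) n f :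
  (forall A, measurable A -> \int[pi]_x P x A = pi A) ->
  measurable_fun setT f -> (forall y, 0 <= f y) ->
  \int[pi]_x kpow n f x = \int[pi]_x f x.
Proof.
move=> hpi mf f0; elim: n => [|n IH]; first by rewrite kpow0.
have mk := measurable_kpow n mf f0; have k0 := kpow_ge0 n f0.
transitivity (\int[pi]_x \int[P x]_y kpow n f y).
  by apply: eq_integral => x _; exact: kpowS.
transitivity (\int[pi]_x \int[\d_x]_y kpow n f y); last first.
  by rewrite -IH; exact: integral_dirac_kernel.
apply: ge0_eq_integral_mixture => //.
- by move=> A mA; exact: measurable_kernel.
- exact: measurable_dirac_kernel.
- by move=> A mA; rewrite hpi// integral_dirac_set.
Qed.

End kernel_powers.

Section markov_property.
Local Open Scope ereal_scope.
Context {dT : measure_display} {T : measurableType dT} {R : realType}.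
Context {dO : measure_display} {Omega : measurableType dO}.
Variables (Pr : probability Omega R) (P : R.-pker T ~> T) (nu : probability T R).
Variable X : nat -> {RV Pr >-> T}.
Hypothesis hX : markov_chain Pr P nu X.
Implicit Types f : T -> \bar R.

Lemma measurable_X n : measurable_fun setT (X n).
Proof. exact: measurable_funPT. Qed.

Lemma measurable_event n (B : set T) : measurable B -> measurable (X n @^-1` B).
Proof. by move=> mB; rewrite -[_ @^-1` _]setTI; exact: measurable_X. Qed.

Lemma past_event i n (B : set T) : measurable B -> (i <= n)%N ->
  g_sigma_preimage (fun i : 'I_n.+1 => X i : Omega -> T) (X i @^-1` B).
Proof.
move=> mB ein; apply: sub_gen_smallest.
rewrite (bigD1 (Ordinal (ein : (i < n.+1)%N)))//=; left.
by exists B => //; rewrite setTI.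
Qed.

(** The Markov property is known for indicators of future events, and both
    sides are integrals against kernels in the future variable. *)
Lemma markov_step i n (B : set T) f : measurable B -> (i <= n)%N ->
  measurable_fun setT f -> (forall y, 0 <= f y) ->
  \int[Pr]_(w in X i @^-1` B) f (X n.+1 w) =
  \int[Pr]_(w in X i @^-1` B) \int[P (X n w)]_y f y.
Proof.
move=> mB ein mf f0; have mE := measurable_event i mB.
transitivity (\int[Pr]_(w in X i @^-1` B) \int[\d_(X n.+1 w)]_y f y).
  by apply: eq_integral => w _; rewrite integral_dirac// diracT mul1e.
apply: ge0_eq_integral_mixture => //.
- move=> A mA; apply: (measurableT_comp (f := fun x => \d_x A : \bar R)).
    exact: measurable_dirac_kernel.
  exact: measurable_X.
- move=> A mA; apply: (measurableT_comp (f := fun x => P x A)).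
    exact: measurable_kernel.
  exact: measurable_X.
move=> A mA; rewrite -(hX.2 n A _ mA (past_event mB ein)) setIC.
rewrite -integral_indic//; last exact: measurable_event.
Qed.

(** The step of the chain from [n] to [n.+1] uses up the first factor of
    P^(k+1) = P P^k, so that the induction on [k] moves the time [n]. *)
Lemma markov_powers i n k (B : set T) f : measurable B -> (i <= n)%N ->
  measurable_fun setT f -> (forall y, 0 <= f y) ->
  \int[Pr]_(w in X i @^-1` B) f (X (n + k)%N w) =
  \int[Pr]_(w in X i @^-1` B) kpow P k f (X n w).
Proof.
move=> mB + mf f0; elim: k n => [|k IH] n ein.
  by rewrite addn0 kpow0.
rewrite addnS -addSn IH; last exact: leqW.
rewrite (markov_step (f := kpow P k f))//; last 2 first.
- exact: measurable_kpow.
- exact: kpow_ge0.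
by apply: eq_integral => w _; rewrite kpowS.
Qed.

Lemma markov_law n f : measurable_fun setT f -> (forall y, 0 <= f y) ->
  \int[Pr]_w f (X n w) = \int[nu]_x kpow P n f x.
Proof.
move=> mf f0.
have := @markov_powers 0 0 n setT f measurableT isT mf f0.
rewrite preimage_setT add0n => ->.
transitivity (\int[distribution Pr (X 0%N)]_x kpow P n f x).
  by rewrite ge0_integral_distribution//; [exact: measurable_kpow|exact: kpow_ge0].
by apply: eq_measure_integral => A mA _; exact: hX.1.
Qed.

End markov_property.

(** * Three-factor Hoelder inequality along the chain *)

(** Young's inequality up to a constant: if M is the largest of the three
    powers, then the product is at most M^(1/r) M^(1/s) M^(1/2) = M. *)
Lemma prod3_le_sum_powers (R : realType) (r s x y z : R) :
  0 < r -> 0 < s -> r^-1 + s^-1 + 2^-1 = 1 -> 0 <= x -> 0 <= y -> 0 <= z ->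
  x * y * z <= x `^ r + y `^ s + z ^+ 2.
Proof.
move=> r0 s0 rs x0 y0 z0.
pose M := Num.max (x `^ r) (Num.max (y `^ s) (z ^+ 2)).
have M0 : 0 <= M by rewrite le_max powR_ge0.
have root (a t : R) : 0 <= a -> 0 < t -> a `^ t <= M -> a <= M `^ t^-1.
  move=> a0 t0 aM; rewrite -[leLHS]powRr1// -(@divff _ t) ?gt_eqF// powRrM.
  by apply: ge0_ler_powR => //; rewrite ?invr_ge0 ?ltW// nnegrE powR_ge0.
have xM : x <= M `^ r^-1 by apply: root => //; rewrite le_max lexx.
have yM : y <= M `^ s^-1 by apply: root => //; rewrite !le_max lexx orbT.
have zM : z <= M `^ 2^-1.
  by apply: root => //; rewrite powR_mulrn// !le_max lexx !orbT.
apply: (@le_trans _ _ M).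
  rewrite -[leRHS]powRr1// -rs powRD; last by rewrite rs oner_eq0.
  rewrite powRD; last by rewrite gt_eqF// addr_gt0// invr_gt0.
  by rewrite !ler_pM// mulr_ge0.
have a0 := powR_ge0 x r; have b0 := powR_ge0 y s; have c0 : 0 <= z ^+ 2 by exact: exprn_ge0.
by rewrite !ge_max; apply/andP; split; [|apply/andP; split]; lra.
Qed.

Section domination.
Local Open Scope ereal_scope.
Context {dT : measure_display} {T : measurableType dT} {R : realType}.
Context {dO : measure_display} {Omega : measurableType dO}.
Variables (Pr : probability Omega R) (P : R.-pker T ~> T) (nu pi : probability T R).
Variable X : nat -> {RV Pr >-> T}.
Hypothesis hX : markov_chain Pr P nu X.
Hypothesis hpi : invariant_measure P pi.
Variables (r s H : R) (h : T -> R).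
Hypotheses (r0 : (0 < r)%R) (s0 : (0 < s)%R) (rs : (r^-1 + s^-1 + 2^-1 = 1)%R).
Hypotheses (H0 : (0 < H)%R) (mh : measurable_fun setT h).
Hypothesis hH : \int[pi]_x (`|h x| `^ r)%:E <= (H `^ r)%:E.
Hypothesis nu_h : forall f : T -> R, measurable_fun setT f ->
  (forall x, 0 <= f x <= 1)%R -> \int[nu]_x (f x)%:E <= \int[pi]_x (f x * `|h x|)%:E.

(** Hoelder's inequality on pi(dx) P^n(x, dy) for h(x), u(y) and v(y), obtained
    by integrating [prod3_le_sum_powers] for the normalized functions.  Each
    normalized power has integral at most 1, because both marginals are [pi];
    hence the factor 3. *)
Lemma law_product_le n (u v : T -> R) (b c : R) :
  measurable_fun setT u -> (forall x, 0 <= u x <= 1)%R ->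
  measurable_fun setT v -> (forall x, 0 <= v x <= 1)%R ->
  (0 < b)%R -> \int[pi]_x (u x `^ s)%:E <= (b `^ s)%:E ->
  (0 < c)%R -> \int[pi]_x (v x ^+ 2)%:E <= (c ^+ 2)%:E ->
  \int[Pr]_w (u (X n w) * v (X n w))%:E <= (3 * (H * b * c))%:E.
Proof.
move=> mu u01 mv v01 b0 ub c0 vc.
have u0 x : (0 <= u x)%R by have /andP[] := u01 x.
have v0 x : (0 <= v x)%R by have /andP[] := v01 x.
have muv : measurable_fun setT (fun x => (u x * v x)%:E).
  by apply/measurable_EFinP; exact: measurable_funM.
have uv0 x : 0 <= (u x * v x)%:E by rewrite lee_fin mulr_ge0.
rewrite (markov_law hX n muv uv0).
set f := kpow P n _.
have mf : measurable_fun setT f by exact: measurable_kpow.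
have f0 x : 0 <= f x by exact: kpow_ge0.
have iter1 x : kernel_iter P n x setT <= 1 by exact: sprob_kernel_le1.
have f1 x : f x <= 1.
  apply: le_trans (iter1 x); rewrite -[leRHS]mul1e -integral_cst//.
  apply: ge0_le_integral => // y _; rewrite lee_fin.
  by rewrite mulr_ile1// ?u0 ?v0//; [have /andP[] := u01 y|have /andP[] := v01 y].
have ffin x : f x \is a fin_num by rewrite ge0_fin_numE// (le_lt_trans (f1 x))// ltry.
have mf' : measurable_fun setT (fun x => fine (f x)) by exact: measurableT_comp.
have f'01 x : (0 <= fine (f x) <= 1)%R.
  by rewrite fine_ge0//= -lee_fin fineK.
rewrite (eq_integral (fun x => (fine (f x))%:E)); last by move=> x _; rewrite fineK.
apply: (le_trans (nu_h mf' f'01)).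
pose U (x : T) : \bar R := ((u x / b) `^ s)%:E.
pose V (x : T) : \bar R := ((v x / c) ^+ 2)%:E.
pose W (x : T) : \bar R := ((`|h x| / H) `^ r)%:E.
have mU : measurable_fun setT U.
  apply/measurable_EFinP; apply: (measurableT_comp (f := fun t : R => t `^ s)%R) => //.
  exact: measurable_funM.
have mV : measurable_fun setT V.
  by apply/measurable_EFinP; apply: measurable_funX; exact: measurable_funM.
have mW : measurable_fun setT W.
  apply/measurable_EFinP; apply: (measurableT_comp (f := fun t : R => t `^ r)%R) => //.
  by apply: measurable_funM => //; exact: measurableT_comp.
have U0 x : 0 <= U x by rewrite lee_fin powR_ge0.
have V0 x : 0 <= V x by rewrite lee_fin exprn_ge0// divr_ge0// ltW.
have W0 x : 0 <= W x by rewrite lee_fin powR_ge0.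
have K0 : (0 <= H * b * c)%R by rewrite !mulr_ge0// ltW.
have mkU := measurable_kpow P n mU U0.
have mkV := measurable_kpow P n mV V0.
have kU0 := kpow_ge0 P n U0.
have kV0 := kpow_ge0 P n V0.
apply: (@le_trans _ _ (\int[pi]_x ((H * b * c)%:E * (W x + (kpow P n U x + kpow P n V x))))).
  apply: ge0_le_integral => //.
  - by move=> x _; rewrite lee_fin mulr_ge0// fine_ge0.
  - apply/measurable_EFinP; apply: measurable_funM => //; exact: measurableT_comp.
  - by apply: measurable_funeM; apply: emeasurable_funD => //; exact: emeasurable_funD.
  move=> x _; rewrite EFinM fineK// muleC -ge0_integralZl//.
  apply: (@le_trans _ _ (\int[kernel_iter P n x]_y
      ((H * b * c)%:E * (W x + (U y + V y))))).
    apply: ge0_le_integral => //.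
    - by move=> y _; rewrite mule_ge0.
    - by apply: measurable_funeM.
    - apply: measurable_funeM; apply: emeasurable_funD => //; exact: emeasurable_funD.
    move=> y _; rewrite -!EFinD -!EFinM lee_fin addrA.
    have -> : (`|h x| * (u y * v y) =
       H * b * c * ((`|h x| / H) * (u y / b) * (v y / c)))%R.
      by field; rewrite !gt_eqF.
    apply: ler_wpM2l => //; apply: prod3_le_sum_powers => //.
    + by rewrite divr_ge0// ltW.
    + by rewrite divr_ge0// ltW.
    + by rewrite divr_ge0// ltW.
  rewrite ge0_integralZl//; last 2 first.
  - apply: emeasurable_funD => //; exact: emeasurable_funD.
  - by move=> y _; rewrite !adde_ge0.
  apply: lee_wpmul2l; first by rewrite lee_fin.
  rewrite ge0_integralD//; last 2 first.
  - by move=> y _; rewrite adde_ge0.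
  - exact: emeasurable_funD.
  rewrite (ge0_integralD _ _ _ _ _ mV)//; apply: leeD => //.
  by rewrite integral_cst// -[leRHS]mule1; apply: lee_wpmul2l; [exact: W0|exact: iter1].
have normal (g : T -> R) (t a : R) : (0 < a)%R -> (0 < t)%R -> measurable_fun setT g ->
    (forall x, 0 <= g x)%R -> \int[pi]_x (g x `^ t)%:E <= (a `^ t)%:E ->
    \int[pi]_x ((g x / a) `^ t)%:E <= 1.
  move=> a0 t0 mg g0 ga.
  have at0 : (0 < a `^ t)%R by rewrite powR_gt0.
  rewrite (eq_integral (fun x => ((a `^ t)^-1)%:E * (g x `^ t)%:E)); last first.
    move=> x _ /=; rewrite -EFinM powRM ?invr_ge0 ?(ltW a0)// mulrC.
    by rewrite -powR_inv1 ?(ltW a0)// -powRrM mulN1r powRN.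
  rewrite ge0_integralZl//.
  - rewrite (_ : 1 = ((a `^ t)^-1)%:E * (a `^ t)%:E).
      by apply: lee_wpmul2l => //; rewrite lee_fin invr_ge0 ltW.
    by rewrite -EFinM mulVf// gt_eqF.
  - apply/measurable_EFinP; exact: (measurableT_comp (f := fun y : R => y `^ t)%R).
  - by move=> x _; rewrite lee_fin powR_ge0.
  - by rewrite lee_fin invr_ge0 ltW.
have W1 : \int[pi]_x W x <= 1.
  by apply: (normal (fun x => `|h x|)%R) => //; exact: measurableT_comp.
have U1 : \int[pi]_x U x <= 1 by exact: (normal u).
have V1 : \int[pi]_x V x <= 1.
  rewrite (eq_integral (fun x => ((v x / c) `^ 2)%:E)).
    apply: (normal v) => //; rewrite powR_mulrn ?(ltW c0)//.
    rewrite (eq_integral (fun x => (v x ^+ 2)%:E))// => x _.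
    by rewrite powR_mulrn.
  by move=> x _; rewrite powR_mulrn// divr_ge0// ltW.
rewrite ge0_integralZl//; last first.
- by move=> y _; apply: adde_ge0; [exact: W0|apply: adde_ge0; [exact: kU0|exact: kV0]].
- apply: emeasurable_funD => //; exact: emeasurable_funD.
rewrite (mulrC 3%R) (EFinM _ 3%R); apply: lee_wpmul2l; first by rewrite lee_fin.
rewrite ge0_integralD//; last 2 first.
- by move=> y _; rewrite adde_ge0.
- exact: emeasurable_funD.
rewrite (ge0_integralD _ _ _ _ _ mkV)// !integral_kpow//.
rewrite (_ : 3%:E = 1 + (1 + 1)); last by rewrite -!EFinD; congr (_%:E); ring.
by apply: leeD => //; exact: leeD.
Qed.

End domination.

(** * Deviation of the empirical measure on one set *)

Section bounded_expectation.
Context {dO : measure_display} {Omega : measurableType dO} {R : realType}.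
Variable Pr : probability Omega R.
Implicit Types F G : Omega -> R.

Definition bounded_measurable F :=
  measurable_fun setT F /\ exists M, forall w, `|F w| <= M.

Lemma bounded_measurable_integrable F : bounded_measurable F ->
  Pr.-integrable setT (EFin \o F).
Proof.
move=> [mF [M FM]]; apply: measurable_bounded_integrable => //.
  by rewrite ltey_eq fin_num_measure.
exists M; split; first exact: num_real.
by move=> y My w _; apply: le_trans (FM w) (ltW My).
Qed.

Lemma bounded_measurableD F G : bounded_measurable F -> bounded_measurable G ->
  bounded_measurable (fun w => F w + G w).
Proof.
move=> [mF [M FM]] [mG [N GN]]; split; first exact: measurable_funD.
exists (M + N) => w; apply: le_trans (ler_normD _ _) _; exact: lerD.
Qed.

Lemma bounded_measurableM F G : bounded_measurable F -> bounded_measurable G ->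
  bounded_measurable (fun w => F w * G w).
Proof.
move=> [mF [M FM]] [mG [N GN]]; split; first exact: measurable_funM.
by exists (M * N) => w; rewrite normrM; apply: ler_pM.
Qed.

Lemma bounded_measurable_cst (a : R) : bounded_measurable (fun=> a).
Proof. by split; [exact: measurable_cst|exists `|a|]. Qed.

Lemma bounded_measurable_sum (I : Type) (s : seq I) (F : I -> Omega -> R) :
  (forall i, bounded_measurable (F i)) ->
  bounded_measurable (fun w => \sum_(i <- s) F i w).
Proof.
move=> bF; elim: s => [|i s IH].
  by under eq_fun do rewrite big_nil; exact: bounded_measurable_cst.
by under eq_fun do rewrite big_cons; exact: bounded_measurableD.
Qed.

Lemma bounded_measurable_norm F : bounded_measurable F ->
  bounded_measurable (fun w => `|F w|).
Proof.
move=> [mF [M FM]]; split; first exact: measurableT_comp.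
by exists M => w; rewrite normr_id.
Qed.

Lemma Rintegral_bounded_sum (I : Type) (s : seq I) (F : I -> Omega -> R) :
  (forall i, bounded_measurable (F i)) ->
  \int[Pr]_w (\sum_(i <- s) F i w) = \sum_(i <- s) \int[Pr]_w F i w.
Proof.
move=> bF; elim: s => [|i s IH].
  rewrite big_nil; under eq_Rintegral do rewrite big_nil.
  by rewrite Rintegral_cst// mul0r.
rewrite big_cons -IH; under eq_Rintegral do rewrite big_cons.
by rewrite RintegralD//; apply: bounded_measurable_integrable => //;
  exact: bounded_measurable_sum.
Qed.

Lemma EFin_Rintegral F : bounded_measurable F ->
  (\int[Pr]_w (F w)%:E = (\int[Pr]_w F w)%R%:E)%E.
Proof.
move=> bF; rewrite /Rintegral fineK//.
by apply: integrable_fin_num => //; exact: bounded_measurable_integrable.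
Qed.

End bounded_expectation.

Section lag_sums.
Context {R : realType}.
Variables (tau : nat -> R) (S : R).
Hypothesis tau0 : forall k, 0 <= tau k.
Hypothesis tauS : forall N, \sum_(0 <= k < N) tau k <= S.

(** In truncated subtraction, (i - j) + (j - i) is the distance of i and j. *)
Lemma sum_lags_le (N i : nat) : (i < N)%N ->
  \sum_(0 <= j < N) tau ((i - j) + (j - i))%N <= 2 * S.
Proof.
move=> iN; rewrite (big_cat_nat (leq0n i.+1) iN)/= mulr_natl mulr2n lerD//.
  apply: le_trans (tauS i.+1); rewrite big_nat_rev/= le_eqVlt; apply/orP; left.
  apply/eqP/eq_big_nat => j /andP[_ ji]; congr tau; lia.
apply: le_trans (tauS (N - i)); rewrite -{1}(add0n i.+1) big_addn.
have -> : \sum_(0 <= j < N - i) tau j = tau 0%N + \sum_(0 <= j < N - i.+1) tau j.+1.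
  by rewrite -{1}(subnSK iN) big_nat_recl.
rewrite -[leLHS]add0r lerD// le_eqVlt; apply/orP; left.
apply/eqP/eq_big_nat => j _; congr tau; lia.
Qed.

End lag_sums.

Section empirical_deviation.
Context {dT : measure_display} {T : measurableType dT} {R : realType}.
Context {dO : measure_display} {Omega : measurableType dO}.
Variables (Pr : probability Omega R) (P : R.-pker T ~> T) (nu pi : probability T R).
Variable X : nat -> {RV Pr >-> T}.
Hypothesis hX : markov_chain Pr P nu X.
Hypothesis hpi : invariant_measure P pi.
Variables (r s H : R) (h : T -> R).
Hypotheses (r0 : (0 < r)%R) (s0 : (0 < s)%R) (rs : (r^-1 + s^-1 + 2^-1 = 1)%R).
Hypotheses (H0 : (0 < H)%R) (mh : measurable_fun setT h).
Hypothesis hH : (\int[pi]_x (`|h x| `^ r)%:E <= (H `^ r)%:E)%E.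
Hypothesis nu_h : forall f : T -> R, measurable_fun setT f ->
  (forall x, 0 <= f x <= 1)%R -> (\int[nu]_x (f x)%:E <= \int[pi]_x (f x * `|h x|)%:E)%E.
Variables (tau : nat -> R) (S : R).
Hypothesis tau0 : forall k, 0 < tau k.
Hypothesis tauS : forall N, \sum_(0 <= k < N) tau k <= S.
Hypothesis L2decay : forall k (A : set T), measurable A ->
  (\int[pi]_x ((fine (kernel_iter P k x A) - fine (pi A)) ^+ 2)%:E <=
   (tau k ^+ 2 * (2 * fine (pi A)))%:E)%E.

Lemma S_gt0 : 0 < S.
Proof. by apply: lt_le_trans (tauS 1); rewrite big_nat1. Qed.

Section one_set.
Variables (A : set T) (b : R).
Hypotheses (mA : measurable A) (b0 : 0 < b) (Ab : fine (pi A) <= b).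
Let a := fine (pi A).
Let one n w : R := \1_A (X n w).
Let g k x : R := fine (kernel_iter P k x A).

Let a01 : 0 <= a <= 1.
Proof.
rewrite fine_ge0//= -lee_fin fineK ?fin_num_measure//; exact: probability_le1.
Qed.

Let piA : pi A = a%:E. Proof. by rewrite fineK// fin_num_measure. Qed.

Let iter1 k x : (kernel_iter P k x A <= 1)%E.
Proof.
apply: (@le_trans _ _ (kernel_iter P k x setT)); last exact: sprob_kernel_le1.
by apply: le_measure; rewrite ?inE.
Qed.

Let iter_fin k x : kernel_iter P k x A \is a fin_num.
Proof. by rewrite ge0_fin_numE// (le_lt_trans (iter1 k x))// ltry. Qed.

Let g01 k x : 0 <= g k x <= 1.
Proof. by rewrite fine_ge0//= -lee_fin fineK. Qed.

Let mg k : measurable_fun setT (g k).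
Proof. by apply: measurableT_comp => //; exact: measurable_kernel. Qed.

Let bX (f : T -> R) n : measurable_fun setT f -> (forall x, 0 <= f x <= 1) ->
  bounded_measurable (fun w => f (X n w)).
Proof.
move=> mf f01; split.
  by apply: (measurableT_comp mf); exact: measurable_X.
by exists 1 => w; rewrite ger0_norm; have /andP[] := f01 (X n w).
Qed.

Let ind01 x : 0 <= (\1_A x : R) <= 1.
Proof. by rewrite indicE; case: (x \in A); rewrite /= ?lexx ler01. Qed.

Let b_one n : bounded_measurable (one n).
Proof. by apply: (bX (f := \1_A)) => //; exact: measurable_indic. Qed.

Let b_g k n : bounded_measurable (fun w => g k (X n w)).
Proof. exact: bX. Qed.

Let kpow_indic k x : kpow P k (fun y => (\1_A y)%:E) x = (g k x)%:E.
Proof. by rewrite /kpow integral_indic// setIT /g fineK. Qed.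

Let E_one_one i k : (\int[Pr]_w (one i w * one (i + k)%N w)%:E =
  \int[Pr]_w (one i w * g k (X i w))%:E)%E.
Proof.
have mI : measurable_fun setT (fun y : T => (\1_A y)%:E : \bar R).
  exact/measurable_EFinP/measurable_indic.
have I0 (y : T) : (0 <= (\1_A y)%:E :> \bar R)%E by rewrite lee_fin.
have := markov_powers hX k mA (leqnn i) mI I0.
rewrite integral_mkcond [in RHS]integral_mkcond !epatch_indic.
have indE (w : Omega) : \1_(X i @^-1` A) w = one i w :> R by rewrite /one !indicE.
move=> E; transitivity (\int[Pr]_w ((fun w => (\1_A (X (i + k)%N w))%:E) \* (EFin \o \1_(X i @^-1` A)))%E w)%E.
  by apply: eq_integral => w _ /=; rewrite indE -EFinM mulrC.
rewrite E; apply: eq_integral => w _ /=.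
by rewrite indE kpow_indic -EFinM mulrC.
Qed.

Let E_one i k : (\int[Pr]_w (one (i + k)%N w)%:E = \int[Pr]_w (g k (X i w))%:E)%E.
Proof.
have mI : measurable_fun setT (fun y : T => (\1_A y)%:E : \bar R).
  exact/measurable_EFinP/measurable_indic.
have I0 (y : T) : (0 <= (\1_A y)%:E :> \bar R)%E by rewrite lee_fin.
have := markov_powers hX k measurableT (leqnn i) mI I0.
rewrite preimage_setT => ->.
by apply: eq_integral => w _; rewrite kpow_indic.
Qed.

Let dev01 x : 0 <= `|\1_A x - a| <= 1.
Proof.
have /andP[? ?] := a01; have /andP[? ?] := ind01 x.
by rewrite normr_ge0/= ler_norml; apply/andP; split; lra.
Qed.

Let gdev01 k x : 0 <= `|g k x - a| <= 1.
Proof.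
have /andP[? ?] := a01; have /andP[? ?] := g01 k x.
by rewrite normr_ge0/= ler_norml; apply/andP; split; lra.
Qed.

Let mdev : measurable_fun setT (fun x => `|\1_A x - a| : R).
Proof.
apply: measurableT_comp => //; apply: measurable_funB => //.
Qed.

Let mgdev k : measurable_fun setT (fun x => `|g k x - a| : R).
Proof. by apply: measurableT_comp => //; exact: measurable_funB. Qed.

Let integral_dev : (\int[pi]_x (`|\1_A x - a| `^ s)%:E <=
  (((2 * b) `^ s^-1) `^ s)%:E)%E.
Proof.
have s1 : 1 <= s.
  have : s^-1 <= 1 by have := invr_ge0 r; rewrite (ltW r0) => h1; move: rs; lra.
  by rewrite invf_le1.
have /andP[a0 a1] := a01.
rewrite -powRrM mulVf ?gt_eqF// powRr1 ?mulr_ge0 ?(ltW b0)//.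
apply: (@le_trans _ _ (\int[pi]_x ((\1_A x)%:E + a%:E))%E); last first.
  rewrite ge0_integralD//; last exact/measurable_EFinP/measurable_indic.
  have -> : (\int[pi]_x (\1_A x)%:E = a%:E)%E.
    by rewrite integral_indic// setIT; exact: piA.
  have -> : (\int[pi]_x a%:E = a%:E)%E.
    by rewrite integral_cst// [X in (_ * X)%E](probability_setT pi) mule1.
  by rewrite -EFinD lee_fin -mulr2n mulr_natl lerMn2r.
apply: ge0_le_integral => //.
- by apply/measurable_EFinP; exact: (measurableT_comp (f := fun t : R => t `^ s)).
- by apply: emeasurable_funD => //; exact/measurable_EFinP/measurable_indic.
move=> x _; rewrite -EFinD lee_fin.
have /andP[d0 d1] := dev01 x.
apply: (@le_trans _ _ `|\1_A x - a|); last first.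
  by apply: le_trans (ler_normB _ _) _; rewrite !ger0_norm.
have [->|dn0] := eqVneq `|\1_A x - a| 0; first by rewrite powR0// gt_eqF.
by apply: ge1r_powR => //; rewrite lt0r dn0 d0.
Qed.

(** By the Markov property 1_A(X_(i+k)) can be replaced by (P^k 1_A)(X_i), and
    [law_product_le] applies to 1_A - pi(A) and P^k 1_A - pi(A).  The bound [b]
    of pi(A) is a parameter because it has to be positive. *)
Lemma covariance_le i k :
  `|\int[Pr]_w ((one i w - a) * (one (i + k)%N w - a))| <=
  3 * (H * (2 * b) `^ s^-1 * (tau k * Num.sqrt (2 * b))).
Proof.
have bc t : @bounded_measurable _ Omega R (fun=> t) by exact: bounded_measurable_cst.
(* Both covariances expand into the same four integrals. *)
have expand (U V : Omega -> R) : bounded_measurable U -> bounded_measurable V ->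
    \int[Pr]_w ((U w - a) * (V w - a)) =
    \int[Pr]_w (U w * V w) - a * (\int[Pr]_w U w) - a * (\int[Pr]_w V w) + a ^+ 2.
  move=> bU bV.
  rewrite (@eq_Rintegral _ _ _ _ _ (fun w => (U w * V w + (- a) * U w) + ((- a) * V w + a ^+ 2))); last first.
    by move=> w _ /=; ring.
  have bN (W : Omega -> R) : bounded_measurable W -> bounded_measurable (fun w => - a * W w).
    by move=> bW; exact: (bounded_measurableM (bounded_measurable_cst (- a)) bW).
  rewrite RintegralD//; [|apply: bounded_measurable_integrable..]; last 2 first.
  - by apply: bounded_measurableD; [exact: bounded_measurableM|exact: bN].
  - by apply: bounded_measurableD; [exact: bN|exact: bc].
  rewrite RintegralD//; [|apply: bounded_measurable_integrable..]; last 2 first.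
  - exact: bounded_measurableM.
  - exact: bN.
  rewrite RintegralD//; [|apply: bounded_measurable_integrable..]; last 2 first.
  - exact: bN.
  - exact: bc.
  rewrite !RintegralZl//; [|exact: bounded_measurable_integrable..].
  rewrite Rintegral_cst//= probability_setT/=; ring.
have -> : \int[Pr]_w ((one i w - a) * (one (i + k)%N w - a)) =
    \int[Pr]_w ((one i w - a) * (g k (X i w) - a)).
  rewrite (expand (one i))// (expand (one i))//.
  by congr (_ - _ * _ - _ * _ + _); rewrite /Rintegral ?E_one_one ?E_one.
have bdev : bounded_measurable (fun w => (one i w - a) * (g k (X i w) - a)).
  by apply: bounded_measurableM; apply: bounded_measurableD.
apply: (le_trans (le_normr_Rintegral measurableT (bounded_measurable_integrable Pr bdev))).
rewrite -lee_fin -EFin_Rintegral; last exact: bounded_measurable_norm.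
under eq_integral do rewrite normrM.
have b20 : 0 < 2 * b by rewrite mulr_gt0.
apply: (law_product_le hX hpi r0 s0 rs H0 mh hH nu_h i (mdev) dev01 (mgdev k) (gdev01 k)) => //.
- by rewrite powR_gt0.
- by rewrite mulr_gt0// sqrtr_gt0.
rewrite (eq_integral (fun x => ((g k x - a) ^+ 2)%:E)); last first.
  by move=> x _; rewrite real_normK// num_real.
apply: le_trans (L2decay k mA) _; rewrite lee_fin exprMn sqr_sqrtr ?(ltW b20)//.
by apply: ler_wpM2l; [exact: sqr_ge0|exact: ler_wpM2l].
Qed.

Let al : R := (s^-1 + 2^-1) / 2.

(* 1/s + 1/2 = 2 al is at most 1, whence the constant 2. *)
Let scale_b : (2 * b) `^ s^-1 * Num.sqrt (2 * b) <= 2 * (b `^ al) ^+ 2.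
Proof.
have b20 : 0 <= 2 * b by rewrite mulr_ge0// ltW.
rewrite -powR12_sqrt// -powRD; last first.
  by rewrite gt_eqF// addr_gt0// invr_gt0.
rewrite powRM ?(ltW b0)// -(@powR_mulrn _ _ 2) ?powR_ge0// -powRrM.
rewrite divfK ?pnatr_eq0//; apply: ler_wpM2r; first exact: powR_ge0.
rewrite -[leRHS]powRr1//; apply: ler_powR; first by rewrite ler1n.
have : 0 < r^-1 by rewrite invr_gt0.
by move: rs; lra.
Qed.

Let D : R := 12 * S * H * (b `^ al) ^+ 2.

Let D0 : 0 < D.
Proof. by rewrite !mulr_gt0 ?exprn_gt0 ?powR_gt0// S_gt0. Qed.

Lemma variance_sum_le N :
  \int[Pr]_w ((\sum_(0 <= n < N) (one n.+1 w - a)) ^+ 2) <= N%:R * D.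
Proof.
pose Y n w := one n w - a.
have bY n : bounded_measurable (Y n).
  by apply: bounded_measurableD => //; exact: bounded_measurable_cst.
rewrite (@eq_Rintegral _ _ _ _ _ (fun w => \sum_(0 <= i < N) \sum_(0 <= j < N) (Y i.+1 w * Y j.+1 w))); last first.
  by move=> w _; rewrite expr2 mulr_suml; apply: eq_bigr => i _; rewrite mulr_sumr.
rewrite Rintegral_bounded_sum; last first.
  by move=> i; apply: bounded_measurable_sum => j; exact: bounded_measurableM.
have -> : N%:R * D = \sum_(0 <= i < N) D by rewrite sumr_const_nat subn0 mulr_natl.
apply: ler_sum_nat => i /andP[_ iN].
rewrite Rintegral_bounded_sum; last by move=> j; exact: bounded_measurableM.
pose K := 3 * (H * (2 * b) `^ s^-1 * Num.sqrt (2 * b)).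
have K0 : 0 <= K by rewrite !mulr_ge0 ?powR_ge0 ?sqrtr_ge0// ltW.
have cov j : \int[Pr]_w (Y i.+1 w * Y j.+1 w) <= K * tau ((i - j) + (j - i))%N.
  apply: le_trans (ler_norm _) _.
  wlog ij : i j {iN} / (i <= j)%N.
    move=> wl; have [|/ltnW] := leqP i j; first exact: wl.
    move=> /wl; rewrite addnC; under eq_Rintegral do rewrite mulrC.
    exact.
  have := covariance_le i.+1 (j - i); rewrite addSn subnKC//.
  move: (ij); rewrite -subn_eq0 => /eqP ->; rewrite add0n => hc.
  apply: le_trans hc _; rewrite /K le_eqVlt; apply/orP; left; apply/eqP; ring.
apply: le_trans (ler_sum_nat (fun j _ => cov j)) _.
rewrite -mulr_sumr; apply: (@le_trans _ _ (K * (2 * S))).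
  apply: ler_wpM2l => //; apply: (sum_lags_le (fun k => ltW (tau0 k)) tauS iN).
rewrite /K /D.
have S0 := S_gt0.
have HS : 0 <= 6 * S * H by rewrite !mulr_ge0// ltW.
have := ler_wpM2l HS scale_b; lra.
Qed.

(** The Cauchy-Schwarz inequality, in the form |Z| <= Z^2 / (2 t) + t / 2 for t
    the square root of the bound of the variance. *)
Lemma empirical_dev_le N : (1 <= N)%N ->
  (\int[Pr]_w `|(N%:R^-1 * \sum_(0 <= n < N) one n.+1 w - a)%:E| <=
   (Num.sqrt (12 * S * H) * b `^ al * N%:R `^ (- (1 / 2)))%:E)%E.
Proof.
move=> N1.
have N0 : 0 < N%:R :> R by rewrite ltr0n.
pose Z w := N%:R^-1 * \sum_(0 <= n < N) one n.+1 w - a.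
have ZE w : Z w = N%:R^-1 * \sum_(0 <= n < N) (one n.+1 w - a).
  rewrite /Z sumrB sumr_const_nat subn0 mulrBr -[a *+ N]mulr_natl.
  by rewrite mulrA mulVf ?gt_eqF// mul1r.
have bS : bounded_measurable (fun w => \sum_(0 <= n < N) (one n.+1 w - a)).
  apply: bounded_measurable_sum => n; apply: bounded_measurableD => //.
  exact: bounded_measurable_cst.
have bZ : bounded_measurable Z.
  rewrite (_ : Z = fun w => N%:R^-1 * \sum_(0 <= n < N) (one n.+1 w - a)).
    exact: (bounded_measurableM (bounded_measurable_cst _)).
  by apply/funext => w; exact: ZE.
pose t := Num.sqrt (D / N%:R).
have DN : 0 < D / N%:R by rewrite divr_gt0.
have t0 : 0 < t by rewrite sqrtr_gt0.
have tt : t ^+ 2 = D / N%:R by rewrite sqr_sqrtr// ltW.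
have -> : Num.sqrt (12 * S * H) * b `^ al * N%:R `^ (- (1 / 2)) = t.
  rewrite /t [in RHS]sqrtrM ?(ltW D0)// /D [in RHS]sqrtrM; last first.
    by rewrite !mulr_ge0// ltW// S_gt0.
  rewrite sqrtr_sqr ger0_norm ?powR_ge0// sqrtrV ?(ltW N0)//.
  by congr (_ * _); rewrite powRN div1r powR12_sqrt// ltW.
have bZZ : bounded_measurable (fun w => (2 * t)^-1 * (Z w * Z w) + t / 2).
  apply: bounded_measurableD; last exact: bounded_measurable_cst.
  apply: bounded_measurableM; first exact: bounded_measurable_cst.
  exact: bounded_measurableM.
have -> : (\int[Pr]_w `|(Z w)%:E| = \int[Pr]_w (`|Z w|)%:E)%E by [].
rewrite EFin_Rintegral; last exact: bounded_measurable_norm.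
rewrite lee_fin; apply: (@le_trans _ _ (\int[Pr]_w ((2 * t)^-1 * (Z w * Z w) + t / 2))).
  apply: le_Rintegral => //.
  - by apply: bounded_measurable_integrable; exact: bounded_measurable_norm.
  - exact: bounded_measurable_integrable.
  move=> w _; rewrite -expr2 -(@real_normK _ (Z w)) ?num_real//.
  rewrite -subr_ge0 (_ : _ - _ = (2 * t)^-1 * (`|Z w| - t) ^+ 2).
    by apply: mulr_ge0; rewrite ?sqr_ge0 ?invr_ge0 ?mulr_ge0 ?(ltW t0).
  by field; rewrite gt_eqF.
rewrite RintegralD//; [|apply: bounded_measurable_integrable..]; last 2 first.
- by apply: bounded_measurableM; [exact: bounded_measurable_cst|exact: bounded_measurableM].
- exact: bounded_measurable_cst.
rewrite RintegralZl//; last first.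
  by apply: bounded_measurable_integrable; exact: bounded_measurableM.
rewrite Rintegral_cst//= probability_setT/= mulr1.
have -> : \int[Pr]_w (Z w * Z w) =
    (N%:R^-1) ^+ 2 * \int[Pr]_w ((\sum_(0 <= n < N) (one n.+1 w - a)) ^+ 2).
  rewrite -RintegralZl//; last first.
    by apply: bounded_measurable_integrable; exact: bounded_measurableM.
  by apply: eq_Rintegral => w _; rewrite ZE -exprMn expr2.
have := variance_sum_le N => hv.
have h2 : (N%:R^-1) ^+ 2 * \int[Pr]_w ((\sum_(0 <= n < N) (one n.+1 w - a)) ^+ 2) <= t ^+ 2.
  rewrite tt; apply: le_trans (ler_wpM2l (sqr_ge0 _) hv) _.
  rewrite le_eqVlt; apply/orP; left; apply/eqP; field; by rewrite gt_eqF.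
have h3 : (2 * t)^-1 * (N%:R^-1 ^+ 2 * \int[Pr]_w ((\sum_(0 <= n < N) (one n.+1 w - a)) ^+ 2)) <= t / 2.
  rewrite (_ : t / 2 = (2 * t)^-1 * t ^+ 2); last by field; rewrite gt_eqF.
  by apply: ler_wpM2l => //; rewrite invr_ge0 mulr_ge0// ltW.
lra.
Qed.

Lemma law_le n : (\int[Pr]_w (one n w)%:E <= (3 * H * (b `^ al) ^+ 2)%:E)%E.
Proof.
have mI : measurable_fun setT (\1_A : T -> R) by exact: measurable_indic.
have hI (t : R) : (0 < t) -> forall x : T, (\1_A x : R) `^ t = \1_A x.
  by move=> t0 x; rewrite indicE; case: (x \in A); rewrite /= ?powR1// powR0// gt_eqF.
have -> : (\int[Pr]_w (one n w)%:E = \int[Pr]_w (\1_A (X n w) * \1_A (X n w))%:E)%E.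
  apply: eq_integral => w _; rewrite /one indicE.
  by case: (_ \in _); rewrite /= ?mulr1 ?mulr0.
have pib : (\int[pi]_x (\1_A x)%:E <= b%:E)%E.
  by rewrite integral_indic// setIT [leLHS]piA lee_fin.
have := law_product_le hX hpi r0 s0 rs H0 mh hH nu_h n mI ind01 mI ind01
  (b := b `^ s^-1) (c := b `^ 2^-1).
rewrite !powR_gt0// => /(_ isT) hl.
apply: le_trans (hl _ isT _) _ => {hl}.
- rewrite -powRrM mulVf ?gt_eqF// powRr1 ?(ltW b0)//.
  by under eq_integral do rewrite hI//.
- rewrite powR12_sqrt ?(ltW b0)// sqr_sqrtr ?(ltW b0)//.
  under eq_integral do rewrite -powR_mulrn ?hI//.
  exact: pib.
- rewrite lee_fin -!mulrA ler_pM2l// ler_pM2l//.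
  rewrite -powRD; last by rewrite gt_eqF// addr_gt0// invr_gt0.
  by rewrite -(@powR_mulrn _ _ 2) ?powR_ge0// -powRrM divfK ?pnatr_eq0.
Qed.

Lemma empirical_mean_le N : (1 <= N)%N ->
  (\int[Pr]_w (N%:R^-1 * \sum_(0 <= n < N) one n.+1 w)%:E <=
   (3 * H * (b `^ al) ^+ 2)%:E)%E.
Proof.
move=> N1.
have N0 : 0 < N%:R :> R by rewrite ltr0n.
have bS : bounded_measurable (fun w => \sum_(0 <= n < N) one n.+1 w).
  exact: bounded_measurable_sum.
rewrite EFin_Rintegral; last exact: (bounded_measurableM (bounded_measurable_cst _)).
rewrite RintegralZl//; last exact: bounded_measurable_integrable.
rewrite Rintegral_bounded_sum// lee_fin ler_pdivrMl//.
rewrite (_ : N%:R * _ = \sum_(0 <= n < N) (3 * H * b `^ al ^+ 2)); last first.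
  by rewrite sumr_const_nat subn0 mulr_natl.
apply: ler_sum_nat => n _; rewrite -lee_fin -EFin_Rintegral//; exact: law_le.
Qed.

End one_set.
End empirical_deviation.

(** * Double sums over the scales *)

Section dyadic_sums.
Context {R : realType}.
Implicit Types (a b t y z p q D : R) (n k M L : nat).

Definition exp2 t : R := 2 `^ t.

Lemma exp2_gt0 t : 0 < exp2 t. Proof. exact: powR_gt0. Qed.
Lemma exp2_ge0 t : 0 <= exp2 t. Proof. exact: powR_ge0. Qed.
Hint Resolve exp2_gt0 exp2_ge0 : core.

Lemma exp2D s t : exp2 (s + t) = exp2 s * exp2 t.
Proof. by rewrite /exp2 powRD// pnatr_eq0 implybT. Qed.

Lemma exp20 : exp2 0 = 1. Proof. exact: powRr0. Qed.

Lemma exp2N t : exp2 (- t) = (exp2 t)^-1. Proof. exact: powRN. Qed.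

Lemma ler_exp2 s t : s <= t -> exp2 s <= exp2 t.
Proof. by move=> st; apply: ler_powR => //; rewrite ler1n. Qed.

Lemma exp2_gt1 t : 0 < t -> 1 < exp2 t.
Proof.
move=> t0; have <- : 1 `^ t = 1 :> R by rewrite powR1.
by apply: gt0_ltr_powR; rewrite ?nnegrE ?ltr1n.
Qed.

Lemma exp2_min s t : Num.min (exp2 s) (exp2 t) = exp2 (Num.min s t).
Proof.
case: (leP s t) => h; first by rewrite min_l// ler_exp2.
by rewrite min_r// ler_exp2// ltW.
Qed.

(** A sum along an arithmetic progression telescopes as soon as the summand is
    dominated by the increment of a bounded function. *)
Lemma potential_sum_le (Phi F : R -> R) (lo hi y : R) M :
  (forall z, F z <= Phi (z + 1) - Phi z) ->
  (forall z, lo <= Phi z <= hi) ->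
  \sum_(0 <= n < M) F (n%:R + y) <= hi - lo.
Proof.
move=> FPhi Phib; apply: (@le_trans _ _ (Phi (M%:R + y) - Phi y)).
  elim: M => [|M IH]; first by rewrite big_nil add0r subrr.
  rewrite big_nat_recr//=; have := FPhi (M%:R + y).
  rewrite -natr1 addrAC; move: IH; lra.
by have /andP[_ h1] := Phib (M%:R + y); have /andP[h2 _] := Phib y; lra.
Qed.

(** The summand increases geometrically before the crossing point -y and
    decreases geometrically after it; the bound does not depend on where the
    crossing occurs.  The potential is a sum of two monotone functions, each of
    which grows on one side of the crossing. *)
Lemma tent_sum_le a b : 0 < a -> 0 < b -> exists2 c, 0 <= c &
  forall y M, \sum_(0 <= n < M) exp2 (Num.min (a * (n%:R + y)) (- (b * (n%:R + y)))) <= c.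
Proof.
move=> a0 b0; have ea := exp2_gt1 a0; have eb := exp2_gt1 b0.
pose A := (exp2 a - 1)^-1; pose B := (1 - exp2 (- b))^-1.
have eb' : exp2 (- b) < 1 by rewrite exp2N invf_lt1.
have A0 : 0 < A by rewrite invr_gt0 subr_gt0.
have B0 : 0 < B by rewrite invr_gt0 subr_gt0.
have AE : A * (exp2 a - 1) = 1 by rewrite mulVf// gt_eqF// subr_gt0.
have BE : B * (1 - exp2 (- b)) = 1 by rewrite mulVf// gt_eqF// subr_gt0.
pose Phi z := A * exp2 (Num.min a (a * z)) - B * exp2 (Num.min 0 (- (b * z))).
exists (A * exp2 a + B); first by rewrite addr_ge0 ?mulr_ge0 ?ltW.
move=> y M; rewrite -[B in leRHS]opprK.
apply: (@potential_sum_le Phi (fun z => exp2 (Num.min (a * z) (- (b * z))))); last first.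
  move=> z; rewrite /Phi.
  have h1 : exp2 (Num.min a (a * z)) <= exp2 a by apply: ler_exp2; rewrite ge_min lexx.
  have h2 : exp2 (Num.min 0 (- (b * z))) <= 1 by rewrite -exp20; apply: ler_exp2; rewrite ge_min lexx.
  have h3 := exp2_gt0 (Num.min a (a * z)); have h4 := exp2_gt0 (Num.min 0 (- (b * z))).
  have := ler_wpM2l (ltW A0) h1; have := ler_wpM2l (ltW B0) h2.
  have := mulr_ge0 (ltW A0) (ltW h3); have := mulr_ge0 (ltW B0) (ltW h4).
  by rewrite mulr1 => k1 k2 k3 k4; apply/andP; split; lra.
move=> z; rewrite /Phi.
have upA : A * exp2 (Num.min a (a * z)) <= A * exp2 (Num.min a (a * (z + 1))).
  apply: ler_wpM2l; first exact: ltW.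
  by apply: ler_exp2; rewrite le_min ge_min lexx/= ge_min; apply/orP; right; rewrite ler_pM2l// lerDl.
have upB : B * exp2 (Num.min 0 (- (b * (z + 1)))) <= B * exp2 (Num.min 0 (- (b * z))).
  apply: ler_wpM2l; first exact: ltW.
  apply: ler_exp2; rewrite le_min ge_min lexx/= ge_min; apply/orP; right.
  by rewrite lerN2 ler_pM2l// lerDl.
case: (leP z 0) => z0.
  have -> : Num.min a (a * z) = a * z.
    by rewrite min_r// -[leRHS]mulr1 ler_pM2l// (le_trans z0).
  have -> : Num.min a (a * (z + 1)) = a * z + a.
    by rewrite mulrDr mulr1 min_r// gerDr pmulr_rle0.
  have h : exp2 (Num.min (a * z) (- (b * z))) <= exp2 (a * z) by apply: ler_exp2; rewrite ge_min lexx.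
  rewrite exp2D; move: upB h; have : A * (exp2 (a * z) * exp2 a) - A * exp2 (a * z) = exp2 (a * z).
    by rewrite -[RHS]mul1r -AE; ring.
  lra.
have bz : 0 < b * z by rewrite mulr_gt0.
have -> : Num.min 0 (- (b * z)) = - (b * z) by rewrite min_r// oppr_le0 ltW.
have -> : Num.min 0 (- (b * (z + 1))) = - (b * z) + - b.
  by rewrite mulrDr mulr1 opprD min_r// -opprD oppr_le0 addr_ge0// ltW.
have h : exp2 (Num.min (a * z) (- (b * z))) <= exp2 (- (b * z)) by apply: ler_exp2; rewrite ge_min lexx orbT.
rewrite exp2D; move: upA h; have : B * exp2 (- (b * z)) - B * (exp2 (- (b * z)) * exp2 (- b)) = exp2 (- (b * z)).
  by rewrite -[RHS]mul1r -BE; ring.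
lra.
Qed.

Lemma geometric_sum_le b : 0 < b -> exists2 c, 0 <= c &
  forall M, \sum_(0 <= n < M) exp2 (- (b * n%:R)) <= c.
Proof.
move=> b0; have [c c0 hc] := tent_sum_le b0 b0; exists c => // M.
apply: le_trans (hc 0 M); apply: ler_sum => n _; apply: ler_exp2.
rewrite addr0 le_min lexx andbT.
have : 0 <= b * n%:R by rewrite mulr_ge0// ltW.
by lra.
Qed.

(** The two exponentials cross at n = v / q.  If p > q s, the summand peaks
    there and the peak gives the size of the sum; if p < q s, the sum is
    dominated by n = 0. *)
Lemma shell_sum_le p q s : 0 < p -> p < q -> p <> q * s ->
  exists2 c, 0 <= c & forall v M,
  \sum_(0 <= n < M) (exp2 (p * n%:R) * exp2 (Num.min (- (q * n%:R)) (- (q * s * n%:R) - (1 - s) * v)))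
  <= c * (if p < q * s then exp2 (- ((1 - s) * v)) else exp2 (- ((q - p) / q * v))).
Proof.
move=> p0 pq psq; case: ltP => [plt|ple].
  have d0 : 0 < q * s - p by rewrite subr_gt0.
  have [c c0 hc] := geometric_sum_le d0; exists c => // v M.
  apply: (@le_trans _ _ (\sum_(0 <= n < M) exp2 (- ((q * s - p) * n%:R)) * exp2 (- ((1 - s) * v)))).
    apply: ler_sum => n _; rewrite -!exp2D; apply: ler_exp2.
    rewrite (@le_trans _ _ (p * n%:R + (- (q * s * n%:R) - (1 - s) * v)))//.
      by rewrite lerD2l ge_min lexx orbT.
    by rewrite le_eqVlt; apply/orP; left; apply/eqP; ring.
  by rewrite -mulr_suml ler_wpM2r.
have d0 : 0 < p - q * s by rewrite subr_gt0 lt_neqAle ple andbT; apply/eqP => e; exact: psq.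
have d1 : 0 < q - p by rewrite subr_gt0.
have q0 : 0 < q by apply: lt_trans pq.
have [c c0 hc] := tent_sum_le d0 d1; exists c => // v M.
apply: (@le_trans _ _ (\sum_(0 <= n < M) exp2 (Num.min ((p - q * s) * (n%:R + - (v / q)))
    (- ((q - p) * (n%:R + - (v / q))))) * exp2 (- ((q - p) / q * v)))).
  apply: ler_sum => n _; rewrite -!exp2D; apply: ler_exp2.
  rewrite addr_minl addr_minr minC.
  have -> : p * n%:R + - (q * n%:R) = - ((q - p) * (n%:R - v / q)) - (q - p) / q * v.
    by field; rewrite gt_eqF.
  have -> // : p * n%:R + (- (q * s * n%:R) - (1 - s) * v) =
    (p - q * s) * (n%:R - v / q) - (q - p) / q * v.
  by field; rewrite gt_eqF.
by rewrite -mulr_suml ler_wpM2r.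
Qed.

(** The contribution of the cubes of level [k] of shell [n], where [v] is the
    base 2 logarithm of the size of the sample. *)
Definition scale_term p q D v k n : R :=
  exp2 (p * (n%:R - k%:R)) *
  exp2 (Num.min (- (q * n%:R)) (D * k%:R / 2 - q * n%:R / 2 - v / 2)).

(** The size of the contribution of shell [n] once it has been summed over
    the levels; [s] depends on the regime. *)
Definition shell_term p q s v n : R :=
  exp2 (p * n%:R) * exp2 (Num.min (- (q * n%:R)) (- (q * s * n%:R) - (1 - s) * v)).

Lemma shell_term_le p q s : 0 < p -> p < q -> p <> q * s ->
  exists2 c, 0 <= c & forall v M,
  \sum_(0 <= n < M) shell_term p q s v n <=
    c * (exp2 (- ((1 - s) * v)) + exp2 (- ((q - p) / q * v))).
Proof.
move=> p0 pq psq; have [c c0 hc] := shell_sum_le p0 pq psq.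
exists c => // v M; apply: le_trans (hc v M) _; apply: ler_wpM2l => //.
by case: ifP => _; rewrite ?lerDl ?lerDr.
Qed.

(** Where the terms decay geometrically in the level, only [shell_sum_le] for
    the first level matters. *)
Lemma scale_sum_geometric p q D s d : 0 < p -> p < q -> p <> q * s -> 0 < d ->
  (forall v k n, scale_term p q D v k n <= exp2 (- (d * k%:R)) * shell_term p q s v n) ->
  exists2 c, 0 <= c & forall v L M,
  \sum_(0 <= k < L) \sum_(0 <= n < M) scale_term p q D v k n <=
    c * (if p < q * s then exp2 (- ((1 - s) * v)) else exp2 (- ((q - p) / q * v))).
Proof.
move=> p0 pq psq d0 hT.
have [c c0 hc] := shell_sum_le p0 pq psq.
have [c' c'0 hc'] := geometric_sum_le d0.
exists (c' * c) => [|v L M]; first exact: mulr_ge0.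
apply: (@le_trans _ _ (\sum_(0 <= k < L) (exp2 (- (d * k%:R)) *
    \sum_(0 <= n < M) shell_term p q s v n))).
  by apply: ler_sum => k _; rewrite mulr_sumr; apply: ler_sum => n _; exact: hT.
rewrite -mulr_suml -mulrA; apply: ler_pM => //.
- by apply: sumr_ge0 => k _.
- by apply: sumr_ge0 => n _; rewrite mulr_ge0.
- exact: hc.
Qed.

Lemma scale_sum_large p q D : 0 < p -> p < q -> 0 <= D -> D / 2 < p -> q <> 2 * p ->
  exists2 c, 0 <= c & forall v L M,
  \sum_(0 <= k < L) \sum_(0 <= n < M) scale_term p q D v k n <=
    c * (exp2 (- (v / 2)) + exp2 (- ((q - p) / q * v))).
Proof.
move=> p0 pq D0 Dp q2p.
have psq : p <> q * 2^-1 by move=> e; apply: q2p; rewrite e; field.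
have d0 : 0 < p - D / 2 by rewrite subr_gt0.
have [|c c0 hc] := @scale_sum_geometric p q D 2^-1 (p - D / 2) p0 pq psq d0.
  move=> v k n; rewrite /scale_term /shell_term -!exp2D; apply: ler_exp2.
  have k0 : 0 <= D * k%:R by rewrite mulr_ge0.
  rewrite addrA -lerBlDl le_min; apply/andP; split.
    rewrite lerBlDl; apply: (@le_trans _ _ (p * (n%:R - k%:R) + - (q * n%:R))).
      by rewrite lerD2l ge_min lexx.
    rewrite -subr_ge0; apply: (le_trans (divr_ge0 k0 (ler0n R 2))).
    by rewrite le_eqVlt; apply/orP; left; apply/eqP; field.
  rewrite lerBlDl; apply: (@le_trans _ _ (p * (n%:R - k%:R) + (D * k%:R / 2 - q * n%:R / 2 - v / 2))).
    by rewrite lerD2l ge_min lexx orbT.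
  by rewrite le_eqVlt; apply/orP; left; apply/eqP; field.
exists c => // v L M; apply: le_trans (hc v L M) _; apply: ler_wpM2l => //.
have -> : (1 - 2^-1) * v = v / 2 by field.
by case: ifP => _; rewrite ?lerDl ?lerDr.
Qed.

(** For D = 2p the second argument of the minimum does not decay with the
    level.  If q > 2p, it is simply summed over the L levels.  If q < 2p, no
    factor L is allowed; interpolating a little between the two arguments of
    the minimum restores a geometric decay while keeping p > q s, so that the
    shells still peak at the same place. *)
Lemma scale_sum_critical p q : 0 < p -> p < q -> q <> 2 * p ->
  exists2 c, 0 <= c & forall v L M,
  \sum_(0 <= k < L) \sum_(0 <= n < M) scale_term p q (2 * p) v k n <=
    c * (L%:R * exp2 (- (v / 2)) + exp2 (- ((q - p) / q * v))).
Proof.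
move=> p0 pq q2p; have q0 : 0 < q by apply: lt_trans pq.
have [lt2|] := ltP (2 * p) q.
  have d0 : 0 < q / 2 - p by lra.
  have [c c0 hc] := geometric_sum_le d0.
  exists c => // v L M.
  apply: (@le_trans _ _ (\sum_(0 <= k < L) (c * exp2 (- (v / 2))))); last first.
    by rewrite sumr_const_nat subn0 -[leLHS]mulr_natl mulrCA ler_wpM2l// lerDl.
  apply: ler_sum => k _; apply: le_trans (ler_wpM2r (exp2_ge0 _) (hc M)).
  rewrite mulr_suml; apply: ler_sum => n _.
  rewrite /scale_term -!exp2D; apply: ler_exp2.
  apply: (@le_trans _ _ (p * (n%:R - k%:R) + (2 * p * k%:R / 2 - q * n%:R / 2 - v / 2))).
    by rewrite lerD2l ge_min lexx orbT.
  by rewrite le_eqVlt; apply/orP; left; apply/eqP; field.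
rewrite le_eqVlt => /predU1P[//|q2].
(* [th] is the midpoint of the range 0 < th < 2 p / q - 1 where p > q s. *)
pose th := p / q - 2^-1; pose s := (1 + th) / 2.
have pq1 : p / q < 1 by rewrite ltr_pdivrMr// mul1r.
have pq2 : 2^-1 < p / q by rewrite ltr_pdivlMr//; lra.
have th0 : 0 < th by rewrite /th; lra.
have th1 : th <= 1 by rewrite /th; lra.
have qs : q * s < p.
  rewrite -ltr_pdivlMl// mulrC /s /th; lra.
have d0 : 0 < p * th by rewrite mulr_gt0.
have psq : p <> q * s by move=> e; move: qs; rewrite -e ltxx.
have [|c c0 hc] := @scale_sum_geometric p q (2 * p) s (p * th) p0 pq psq d0.
  move=> v k n; rewrite /scale_term /shell_term -!exp2D; apply: ler_exp2.
  set X := - (q * n%:R); set Y := 2 * p * k%:R / 2 - q * n%:R / 2 - v / 2.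
  have pk : 0 <= p * (1 - th) * k%:R by rewrite !mulr_ge0 ?(ltW p0)// subr_ge0.
  rewrite addrA -lerBlDl le_min; apply/andP; split; rewrite lerBlDl.
    apply: (@le_trans _ _ (p * (n%:R - k%:R) + X)).
      by rewrite lerD2l ge_min lexx.
    rewrite -subr_ge0; apply: (le_trans pk).
    by rewrite le_eqVlt; apply/orP; left; apply/eqP; ring.
  have XY : Num.min X Y <= th * (X) + (1 - th) * Y.
    have h1 : Num.min X Y <= X by rewrite ge_min lexx.
    have h2 : Num.min X Y <= Y by rewrite ge_min lexx orbT.
    have := ler_wpM2l (ltW th0) h1.
    have t1 : 0 <= 1 - th by rewrite subr_ge0.
    have := ler_wpM2l t1 h2; lra.
  apply: (@le_trans _ _ (p * (n%:R - k%:R) + (th * X + (1 - th) * Y))).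
    by rewrite lerD2l.
  rewrite -subr_ge0 le_eqVlt; apply/orP; left; apply/eqP.
  by rewrite /X /Y /s; field.
exists c => // v L M; apply: le_trans (hc v L M) _; apply: ler_wpM2l => //.
by rewrite ltNge (ltW qs)/= lerDr mulr_ge0.
Qed.

(** For a fixed shell the sum over the levels peaks where the two arguments of
    the minimum agree, at k = (v - q n) / D, and has the size of the peak;
    this is the term of [shell_sum_le] for s = 1 - p / D. *)
Lemma scale_sum_small p q D : 0 < p -> p < q -> p < D / 2 -> q <> D * p / (D - p) ->
  exists2 c, 0 <= c & forall v L M,
  \sum_(0 <= k < L) \sum_(0 <= n < M) scale_term p q D v k n <=
    c * (exp2 (- (p / D * v)) + exp2 (- ((q - p) / q * v))).
Proof.
move=> p0 pq pD qne.
have D0 : 0 < D by lra.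
have Dp0 : 0 < D - p by lra.
have psq : p <> q * (1 - p / D).
  move=> e; apply: qne; apply: (@mulIf _ ((D - p) / D)); first by rewrite mulf_neq0// ?invr_eq0 gt_eqF.
  have -> : D * p / (D - p) * ((D - p) / D) = p by field; rewrite !gt_eqF.
  by rewrite [RHS]e; field; rewrite gt_eqF.
have [c c0 hc] := shell_term_le p0 pq psq.
have d0 : 0 < D / 2 - p by lra.
have [c1 c10 hc1] := tent_sum_le d0 p0.
have [c2 c20 hc2] := geometric_sum_le p0.
exists ((c1 + c2) * c) => [|v L M]; first by rewrite mulr_ge0// addr_ge0.
rewrite exchange_big/=.
apply: (@le_trans _ _ (\sum_(0 <= n < M) (c1 + c2) * shell_term p q (1 - p / D) v n)); last first.
  rewrite -mulr_sumr -[leRHS]mulrA; apply: ler_wpM2l; first by rewrite addr_ge0.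
  by have := hc v M; rewrite (_ : 1 - (1 - p / D) = p / D); last by ring.
apply: ler_sum => n _.
rewrite /shell_term; set X := - (q * n%:R); set Y := (X in exp2 (Num.min _ X)).
rewrite -exp2_min; case: (leP (exp2 X) (exp2 Y)) => XY.
  rewrite -exp2D mulrDl (le_trans (y := c2 * exp2 (p * n%:R + X)))//; last first.
    by rewrite lerDr mulr_ge0.
  apply: le_trans (ler_wpM2r (exp2_ge0 _) (hc2 L)); rewrite mulr_suml.
  apply: ler_sum => k _; rewrite /scale_term -!exp2D; apply: ler_exp2.
  apply: (@le_trans _ _ (p * (n%:R - k%:R) + X)).
    by rewrite lerD2l ge_min lexx.
  by rewrite le_eqVlt; apply/orP; left; apply/eqP; ring.
rewrite -exp2D mulrDl (le_trans (y := c1 * exp2 (p * n%:R + Y)))//; last first.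
  by rewrite lerDl mulr_ge0.
apply: le_trans (ler_wpM2r (exp2_ge0 _) (hc1 ((q * n%:R - v) / D) L)); rewrite mulr_suml.
apply: ler_sum => k _; rewrite /scale_term -!exp2D; apply: ler_exp2.
rewrite addr_minl addr_minr minC le_eqVlt; apply/orP; left; apply/eqP.
by congr Num.min; rewrite /Y; field; rewrite gt_eqF.
Qed.

End dyadic_sums.

(** * Consequences of the hypotheses on the moments, the initial law and the kernel *)

Section shell_tail.
Context {R : realType} {d : nat}.
Variables (q : R) (pi : probability (d.-tuple R) R).
Hypotheses (q0 : 0 <= q) (hM : (moment q pi < +oo)%E).

(** Markov's inequality for |x|^q on 2^(n-1) <= |x|. *)
Lemma shell_tail_le : exists2 K, 0 < K &
  forall n, fine (pi (shell_set n)) <= K * exp2 (- (q * n%:R)).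
Proof.
have M0 : (0 <= moment q pi)%E.
  by apply: integral_ge0 => x _; rewrite lee_fin powR_ge0.
pose M := fine (moment q pi).
have ME : moment q pi = M%:E by rewrite fineK// ge0_fin_numE.
have Mge0 : 0 <= M by rewrite fine_ge0.
exists (exp2 q * M + 1); first by rewrite ltr_wpDl// mulr_ge0// powR_ge0.
have mS n := measurable_shell_fiber n : measurable (@shell_set R d n).
case=> [|n].
  rewrite mulr0 oppr0 exp20 mulr1; apply: (@le_trans _ _ 1); last by rewrite lerDr mulr_ge0// powR_ge0.
  by rewrite -lee_fin fineK ?fin_num_measure//; exact: probability_le1.
have h : ((exp2 (q * n%:R))%:E * pi (shell_set n.+1) <= M%:E)%E.
  have me : measurable_fun setT (fun x : d.-tuple R => (enorm x `^ q)%:E).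
    apply/measurable_EFinP; apply: (measurableT_comp (f := fun t : R => t `^ q)) => //.
    exact: measurable_enorm.
  rewrite -ME /moment -integral_cst//.
  apply: (@le_trans _ _ (\int[pi]_(x in shell_set n.+1) (enorm x `^ q)%:E)%E).
    apply: ge0_le_integral => //.
    - by move=> x _; rewrite lee_fin powR_ge0.
    - exact: measurable_funTS.
    move=> x xn; rewrite lee_fin /exp2 mulrC powRrM powR_mulrn//.
    apply: ge0_ler_powR => //; rewrite ?nnegrE ?exprn_ge0 ?enorm_ge0//.
    have := @enorm_ge_shell _ _ x; rewrite xn; exact.
  by apply: ge0_subset_integral => // x _; rewrite lee_fin powR_ge0.
have : exp2 (q * n%:R) * fine (pi (shell_set n.+1)) <= M.
  by rewrite -lee_fin EFinM fineK ?fin_num_measure.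
rewrite -natr1 mulrDr mulr1 opprD exp2D exp2N => h2.
have e0 : 0 < exp2 (q * n%:R) by exact: powR_gt0.
have eq0 : 1 <= exp2 q by rewrite -exp20; apply: ler_exp2.
rewrite mulrC -mulrA ler_pdivlMl// (le_trans h2)//.
rewrite mulrC exp2N mulrDl mul1r mulrAC mulfV ?gt_eqF ?mul1r ?powR_gt0//.
by rewrite lerDl invr_ge0 powR_ge0.
Qed.

End shell_tail.

Section density_hypotheses.
Context {dT : measure_display} {T : measurableType dT} {R : realType}.
Variables (nu pi : probability T R) (r : R).
Hypotheses (r0 : 0 < r) (nupi : nu `<< pi).
Hypothesis hr : ('N[pi]_(r%:E)['d (charge_of_finite_measure nu) '/d pi] < +oo)%E.
Let h x : R := fine (('d (charge_of_finite_measure nu) '/d pi) x).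

Lemma measurable_density : measurable_fun setT h.
Proof.
apply: measurableT_comp => //; exact: measurable_int.
Qed.

Lemma density_Lr : exists2 H, 0 < H &
  (\int[pi]_x (`|h x| `^ r)%:E <= (H `^ r)%:E)%E.
Proof.
have : ('N[pi]_(r%:E)['d (charge_of_finite_measure nu) '/d pi] `^ r < +oo)%E.
  exact: poweR_lty.
rewrite powR_Lnorm ?gt_eqF//.
rewrite (eq_integral (fun x => (`|h x| `^ r)%:E)); last first.
  move=> x _; rewrite /h -[X in (`|X| `^ r)%E]fineK//.
  by apply: Radon_Nikodym_fin_num.
set I := integral _ _ _ => Ifin.
have I0 : (0 <= I)%E by apply: integral_ge0 => x _; rewrite lee_fin powR_ge0.
exists ((fine I + 1) `^ r^-1); first by rewrite powR_gt0// ltr_wpDl// fine_ge0.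
rewrite -powRrM mulVf ?gt_eqF// powRr1; last by rewrite addr_ge0// fine_ge0.
by rewrite EFinD fineK ?ge0_fin_numE// leeDl.
Qed.

Lemma integral_density_le (f : T -> R) : measurable_fun setT f ->
  (forall x, 0 <= f x <= 1) ->
  (\int[nu]_x (f x)%:E <= \int[pi]_x (f x * `|h x|)%:E)%E.
Proof.
move=> mf f01.
have f0 x : 0 <= f x by have /andP[] := f01 x.
have bf : bounded_measurable f.
  by split => //; exists 1 => x; rewrite ger0_norm//; have /andP[] := f01 x.
have hfin x : ('d (charge_of_finite_measure nu) '/d pi) x \is a fin_num.
  exact: Radon_Nikodym_fin_num.
rewrite -(@Radon_Nikodym_change_of_variables _ _ _ nu pi nupi (EFin \o f) setT)//; last first.
  exact: bounded_measurable_integrable.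
apply: le_trans (lee_abs _) _.
have -> : (\int[pi]_x ((EFin \o f) x * ('d (charge_of_finite_measure nu) '/d pi) x) =
           \int[pi]_x (f x * h x)%:E)%E.
  by apply: eq_integral => x _; rewrite EFinM /h fineK.
have mfh : measurable_fun setT (fun x => (f x * h x)%:E).
  by apply/measurable_EFinP; apply: measurable_funM => //; exact: measurable_density.
apply: le_trans (le_abse_integral _ _ _) _ => //.
rewrite le_eqVlt; apply/orP; left; apply/eqP; apply: eq_integral => x _.
by rewrite abse_EFin normrM ger0_norm.
Qed.

End density_hypotheses.

Section mixing_hypotheses.
Context {dT : measure_display} {T : measurableType dT} {R : realType}.
Variables (P : R.-pker T ~> T) (pi : probability T R).
Variables (C0 : R) (rho : nat -> R).
Hypothesis hrho_decr : forall m n, (1 <= m <= n)%N -> rho n <= rho m.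
Hypothesis hrho_lim : rho @ \oo --> 0.
Hypothesis hrho_sum : (\sum_(1 <= n <oo) (rho n)%:E < +oo)%E.
Hypothesis hmix : forall n, (1 <= n)%N ->
  forall f : T -> R, f \in Lfun pi 2%:E ->
  ('N[pi]_(2%:E)[EFin \o (fun x => kernel_op P n f x - \int[pi]_y f y)%R]
   <= (C0 * rho n)%:E
      * 'N[pi]_(2%:E)[EFin \o (fun x => f x - \int[pi]_y f y)%R])%E.

(** The term 2^(-n) keeps the rate positive, so that [law_product_le] can
    divide by it; the rate at lag 0 is the one of the identity operator. *)
Definition decay_rate (n : nat) : R :=
  if n is 0%N then 1 else `|C0| * rho n + exp2 (- n%:R).

Lemma rho_ge0 n : (1 <= n)%N -> 0 <= rho n.
Proof.
move=> n1; have cvr : cvgn rho by apply/cvg_ex; exists 0.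
rewrite -(cvg_lim (@Rhausdorff R) hrho_lim); apply: limr_le => //.
by near=> m; apply: hrho_decr; rewrite n1/=; near: m; exists n.
Unshelve. all: by end_near. Qed.

Lemma decay_rate_gt0 n : 0 < decay_rate n.
Proof.
case: n => [|n] /=; first exact: ltr01.
by rewrite ltr_wpDl// ?powR_gt0// mulr_ge0// rho_ge0.
Qed.

Lemma decay_rate_summable : exists S, forall N, \sum_(0 <= k < N) decay_rate k <= S.
Proof.
have rho0 n : (1 <= n)%N -> (0 <= (rho n)%:E)%E by move=> n1; rewrite lee_fin rho_ge0.
have [c c0 hc] := geometric_sum_le (@ltr01 R).
have s0 : (0 <= \sum_(1 <= n <oo) (rho n)%:E)%E.
  by apply: nneseries_ge0 => n n1 _; exact: rho0.
exists (1 + (`|C0| * fine (\sum_(1 <= n <oo) (rho n)%:E)%E + c)) => N.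
apply: (@le_trans _ _ (\sum_(0 <= k < N.+1) decay_rate k)).
  by rewrite big_nat_recr//= lerDl ltW// decay_rate_gt0.
rewrite big_nat_recl//= lerD2l big_split/= -mulr_sumr; apply: lerD.
  apply: ler_wpM2l => //; rewrite -lee_fin fineK ?ge0_fin_numE//.
  rewrite -sumEFin -(big_add1 _ _ 0 N.+1 xpredT (fun n => (rho n)%:E)).
  by apply: nneseries_lim_ge => n n1 _; exact: rho0.
apply: le_trans (hc N.+1); rewrite [leRHS]big_nat_recl// ler_wpDl ?powR_ge0//.
by apply: ler_sum => k _; rewrite mul1r.
Qed.

(** The mixing assumption for the indicator of [A], whose variance is at most
    2 pi(A). *)
Lemma L2_decay k (A : set T) : measurable A ->
  (\int[pi]_x ((fine (kernel_iter P k x A) - fine (pi A)) ^+ 2)%:E <=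
   (decay_rate k ^+ 2 * (2 * fine (pi A)))%:E)%E.
Proof.
move=> mA; set a := fine (pi A).
have piA : pi A = a%:E by rewrite fineK// fin_num_measure.
have a0 : 0 <= a by rewrite fine_ge0.
have a1 : a <= 1 by rewrite -lee_fin -piA; exact: probability_le1.
have mI : measurable_fun setT (fun x : T => (\1_A x)%:E : \bar R).
  exact/measurable_EFinP/measurable_indic.
have intA : (\int[pi]_x (\1_A x)%:E = a%:E)%E.
  by rewrite integral_indic// setIT; exact: piA.
have dev2 : (\int[pi]_x ((\1_A x - a) ^+ 2)%:E <= (2 * a)%:E)%E.
  apply: (@le_trans _ _ (\int[pi]_x ((\1_A x)%:E + a%:E))%E).
    apply: ge0_le_integral => //.
    - by move=> x _; rewrite lee_fin sqr_ge0.
    - apply/measurable_EFinP; apply: measurable_funX.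
      by apply: measurable_funB => //; exact: measurable_indic.
    - exact: emeasurable_funD.
    move=> x _; rewrite -EFinD lee_fin indicE.
    by case: (x \in A) => /=; rewrite expr2; nra.
  rewrite ge0_integralD// intA.
  have -> : (\int[pi]_x a%:E = a%:E)%E.
    by rewrite integral_cst// [X in (_ * X)%E](probability_setT pi) mule1.
  by rewrite -EFinD lee_fin mulr_natl mulr2n.
case: k => [|k].
  rewrite /= expr1n mul1r; apply: le_trans dev2.
  by rewrite le_eqVlt; apply/orP; left; apply/eqP; apply: eq_integral.
have fL : (\1_A : T -> R) \in Lfun pi 2%:E.
  rewrite inE/=; apply/andP; split; rewrite inE/=; first exact: measurable_indic.
  rewrite /finite_norm unlock poweR_lty//.
  apply: (@le_lt_trans _ _ (\int[pi]_x (\1_A x)%:E)%E); last by rewrite intA ltry.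
  rewrite le_eqVlt; apply/orP; left; apply/eqP; apply: eq_integral => x _ /=.
  by rewrite indicE; case: (x \in A); rewrite /= ?normr1 ?normr0 ?powR1// powR0.
have L2E (g : T -> R) : ('N[pi]_(2%:E)[EFin \o g] `^ 2 = \int[pi]_x (g x ^+ 2)%:E)%E.
  rewrite powR_Lnorm ?pnatr_eq0//; apply: eq_integral => x _ /=.
  by rewrite powR_mulrn// real_normK// num_real.
have := hmix (ltn0Sn k) fL.
have -> : \int[pi]_y \1_A y = a by rewrite /Rintegral intA.
have kE x : kernel_op P k.+1 \1_A x = fine (kernel_iter P k.+1 x A).
  by rewrite /kernel_op /Rintegral integral_indic// setIT.
under [X in Lnorm _ _ X]funext => x do rewrite /= kE.
move=> hN; rewrite -L2E.
set c := `|C0| * rho k.+1.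
have r0 := @rho_ge0 k.+1 isT.
have c0 : 0 <= c by rewrite mulr_ge0.
set N0 := ('N[pi]_(2%:E)[EFin \o (fun x => \1_A x - a)%R])%E in hN.
have N0ge : (0 <= N0)%E by exact: Lnorm_ge0.
have hN' : ('N[pi]_(2%:E)[EFin \o (fun x => (fine (kernel_iter P k.+1 x A) - a)%R)] <= c%:E * N0)%E.
  apply: (le_trans hN); apply: lee_wpmul2r => //.
  by rewrite lee_fin ler_wpM2r// ler_norm.
apply: (@le_trans _ _ ((c%:E * N0) `^ 2)%E).
  apply: gt0_ler_poweR => //; rewrite in_itv/= leey andbT.
  - exact: Lnorm_ge0.
  - by rewrite mule_ge0.
rewrite poweRM// L2E poweR_EFin powR_mulrn//.
apply: (@le_trans _ _ ((c ^+ 2)%:E * (2 * a)%:E)%E).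
  by apply: lee_wpmul2l => //; rewrite lee_fin sqr_ge0.
rewrite -EFinM lee_fin; apply: ler_wpM2r; first by rewrite mulr_ge0.
by rewrite ler_pXn2r ?nnegrE//= ?addr_ge0// ?powR_ge0// lerDl powR_ge0.
Qed.

End mixing_hypotheses.

(** * Expected transport cost *)

Section lower_integral.
Local Open Scope ereal_scope.
Context d (T : measurableType d) (R : realType) (mu : {measure set T -> \bar R}).

Import HBNNSimple.

(** The integral of a nonnegative function is a supremum over the simple
    functions below it, hence monotone even for nonmeasurable functions such
    as the transport cost of the random empirical measure. *)
Lemma ge0_le_integral_nomeas (f g : T -> \bar R) :
  (forall x, 0 <= f x) -> (forall x, f x <= g x) ->
  \int[mu]_x f x <= \int[mu]_x g x.
Proof.
move=> f0 fg; have g0 x : 0 <= g x by apply: le_trans (fg x).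
rewrite !ge0_integralTE//; apply: le_ereal_sup => _ [h hf <-].
by exists h => // x; exact: le_trans (hf x) (fg x).
Qed.

Lemma nneseries_le_partial (u : nat -> \bar R) (c : \bar R) :
  (forall n, 0 <= u n) -> (forall M, \sum_(0 <= n < M) u n <= c) ->
  \sum_(n <oo) u n <= c.
Proof.
move=> u0 uc; apply: lime_le.
  by apply: is_cvg_nneseries => n _ _; exact: u0.
by apply: nearW => M; exact: uc.
Qed.

End lower_integral.

Section multiscale_risk.
Context {R : realType} {d : nat}.
Notation T := (d.-tuple R).
Context {dO : measure_display} {Omega : measurableType dO}.
Variables (Pr : probability Omega R) (P : R.-pker T ~> T) (nu pi : probability T R).
Variable X : nat -> {RV Pr >-> T}.
Hypothesis hX : markov_chain Pr P nu X.
Hypothesis hpi : invariant_measure P pi.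
Variables (p r q H S K : R) (h : T -> R) (tau : nat -> R).
Hypotheses (p0 : 0 < p) (r2 : 2 < r).
Hypotheses (H0 : (0 < H)%R) (mh : measurable_fun setT h).
Hypothesis hH : (\int[pi]_x (`|h x| `^ r)%:E <= (H `^ r)%:E)%E.
Hypothesis nu_h : forall f : T -> R, measurable_fun setT f ->
  (forall x, 0 <= f x <= 1)%R -> (\int[nu]_x (f x)%:E <= \int[pi]_x (f x * `|h x|)%:E)%E.
Hypothesis tau0 : forall k, 0 < tau k.
Hypothesis tauS : forall N, \sum_(0 <= k < N) tau k <= S.
Hypothesis L2decay : forall k (A : set T), measurable A ->
  (\int[pi]_x ((fine (kernel_iter P k x A) - fine (pi A)) ^+ 2)%:E <=
   (tau k ^+ 2 * (2 * fine (pi A)))%:E)%E.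
Hypotheses (K0 : 0 < K)
  (tail : forall n, fine (pi (shell_set n)) <= K * exp2 (- (q * n%:R))).

Let qr : R := q * (r - 1) / r.
Let dr : R := d%:R * (r + 1) / r.
Let s : R := 2 * r / (r - 2).
Let al : R := (s^-1 + 2^-1) / 2.
Let beta n : R := K * exp2 (- (q * n%:R)).

Let r0 : 0 < r. Proof. by apply: lt_trans r2; rewrite ltr0n. Qed.
Let s0 : 0 < s. Proof. by rewrite divr_gt0 ?mulr_gt0 ?subr_gt0. Qed.
Let r20 : 0 < r - 2. Proof. by rewrite subr_gt0. Qed.
Let rs : r^-1 + s^-1 + 2^-1 = 1.
Proof. by rewrite /s; field; rewrite !gt_eqF. Qed.
Let alE : al = (r - 1) / (2 * r).
Proof. by rewrite /al /s; field; rewrite !gt_eqF. Qed.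
Let al0 : 0 < al.
Proof. by have := r2; rewrite alE => h2; rewrite divr_gt0 ?mulr_gt0//; lra. Qed.
Let al1 : al < 1.
Proof.
by have := r2; rewrite alE => h2; rewrite ltr_pdivrMr ?mul1r ?mulr_gt0//; lra.
Qed.
Let al2 : al * 2 <= 1.
Proof.
have := rs; have : 0 < r^-1 by rewrite invr_gt0.
rewrite /al divfK//; lra.
Qed.
Let beta0 n : 0 < beta n. Proof. by rewrite mulr_gt0 ?powR_gt0. Qed.

Let beta_al n : beta n `^ al = K `^ al * exp2 (- (qr * n%:R / 2)).
Proof.
rewrite powRM ?powR_ge0 ?(ltW K0)// /exp2 -powRrM; congr (_ * _ `^ _).
by rewrite alE /qr; field; rewrite gt_eqF.
Qed.

Let beta_al2 n : (beta n `^ al) ^+ 2 = (K `^ al) ^+ 2 * exp2 (- (qr * n%:R)).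
Proof.
by rewrite beta_al exprMn; congr (_ * _); rewrite expr2 -exp2D; congr exp2; field.
Qed.

Let mcell k n j : measurable (@cell R d k n j).
Proof. exact: measurable_cell. Qed.

Let mshell n : measurable (@shell_set R d n).
Proof. exact: measurable_shell_fiber. Qed.

Notation emp N w := (@empirical _ T R (fun n => X n w) N).

Let empE N w A : emp N w A =
  (N%:R^-1 * \sum_(0 <= n < N) \1_A (X n.+1 w))%:E.
Proof.
rewrite /empirical /mscale/= /msum EFinM; congr (_ * _)%E.
by rewrite big_mkord -sumEFin.
Qed.

Let memp N A : measurable A -> measurable_fun setT (fun w => emp N w A).
Proof.
move=> mA; under eq_fun do rewrite empE.
apply/measurable_EFinP; apply: measurable_funM => //.
apply: measurable_sum => n.
have mI : measurable_fun setT (\1_A : T -> R) by exact: measurable_indic.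
exact: (measurableT_comp mI (measurable_X X n.+1)).
Qed.

Let mdevn N A : measurable A ->
  measurable_fun setT (fun w => `|emp N w A - pi A|)%E.
Proof.
move=> mA; apply: measurableT_comp => //; apply: emeasurable_funB => //.
exact: memp.
Qed.

Let piA A : measurable A -> pi A = (fine (pi A))%:E.
Proof. by move=> mA; rewrite fineK// fin_num_measure. Qed.

Let mean_shell N n : (1 <= N)%N ->
  (\int[Pr]_w emp N w (shell_set n) <= (3 * H * (beta n `^ al) ^+ 2)%:E)%E.
Proof.
move=> N1; under eq_integral do rewrite empE.
exact: (empirical_mean_le hX hpi r0 s0 rs H0 mh hH nu_h (mshell n) (beta0 n) (tail n)).
Qed.

Let pi_shell n : fine (pi (shell_set n)) <= (beta n `^ al) ^+ 2.
Proof.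
set x := fine _; have x0 : 0 <= x by rewrite fine_ge0.
have x1 : x <= 1 by rewrite -lee_fin -piA//; exact: probability_le1.
rewrite -powR_mulrn ?powR_ge0// -powRrM.
have [->|xn0] := eqVneq x 0; first exact: powR_ge0.
apply: (@le_trans _ _ (x `^ (al * 2))).
  by apply: ger1_powR => //; rewrite lt0r xn0 x0.
by apply: ge0_ler_powR; [rewrite mulr_ge0 ?(ltW al0)|rewrite nnegrE|rewrite nnegrE ltW|exact: tail].
Qed.

Let C1 : R := (3 * H + 1) * (K `^ al) ^+ 2.

Let shell_mass N n : (1 <= N)%N ->
  (\int[Pr]_w (emp N w (shell_set n) + pi (shell_set n)) <=
   (C1 * exp2 (- (qr * n%:R)))%:E)%E.
Proof.
move=> N1; rewrite ge0_integralD//; last exact: memp.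
have -> : (\int[Pr]_w pi (shell_set n) = pi (shell_set n))%E.
  by rewrite integral_cst// [X in (_ * X)%E](probability_setT Pr) mule1.
rewrite /C1 -mulrA -beta_al2 mulrDl mul1r EFinD; apply: leeD; first exact: mean_shell.
by rewrite piA// lee_fin.
Qed.

Let cell_sum N k n w :=
  (\sum_(j : {ffun 'I_d -> 'I_(2 ^ k.+1).+1}) `|emp N w (cell n j) - pi (cell n j)|)%E.

Let cell_sum_ge0 N k n w : (0 <= cell_sum N k n w)%E.
Proof. by apply: sume_ge0 => j _. Qed.

Let mcell_sum N k n : measurable_fun setT (cell_sum N k n).
Proof. by apply: emeasurable_sum => j; exact: mdevn. Qed.

Let cell_sum_shell N k n : (1 <= N)%N ->
  (\int[Pr]_w cell_sum N k n w <= (C1 * exp2 (- (qr * n%:R)))%:E)%E.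
Proof.
move=> N1; apply: le_trans (shell_mass n N1).
apply: ge0_le_integral => //.
- by apply: emeasurable_funD => //; exact: memp.
move=> w _; rewrite !(shell_set_cells k) -big_split/=.
apply: lee_sum => j _; apply: le_trans (lee_abs_sub _ _) _.
by rewrite !gee0_abs.
Qed.

Let C2 : R := Num.sqrt (12 * S * H) * (2 * K `^ al * exp2 dr).

(* 1 - al = (r + 1) / (2 r), which is where the dimension d_r comes from. *)
Let card_cells k : (#|{ffun 'I_d -> 'I_(2 ^ k.+1).+1}|)%:R `^ (1 - al) <=
  exp2 (dr * k%:R / 2 + dr) :> R.
Proof.
have al10 : 0 <= 1 - al by rewrite subr_ge0 ltW.
rewrite card_ffun !card_ord natrX.
apply: (@le_trans _ _ (((2 ^+ k.+2) ^+ d) `^ (1 - al))).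
  apply: ge0_ler_powR; rewrite ?nnegrE ?exprn_ge0//.
  rewrite lerXn2r ?nnegrE ?exprn_ge0// -natrX ler_nat (expnS 2 k.+1) mul2n -addnn.
  by rewrite -[X in (X <= _)%N]addn1 leq_add2l expn_gt0.
rewrite -exprM -powR_mulrn// -powRrM le_eqVlt; apply/orP; left; apply/eqP.
rewrite /exp2; congr powR; rewrite natrM -addn2 natrD alE /dr; field.
by rewrite gt_eqF.
Qed.

Let cell_sum_scale N k n : (1 <= N)%N ->
  (\int[Pr]_w cell_sum N k n w <=
   (C2 * exp2 (dr * k%:R / 2 - qr * n%:R / 2) * N%:R `^ (- (1 / 2)))%:E)%E.
Proof.
move=> N1; set m : R := (#|{ffun 'I_d -> 'I_(2 ^ k.+1).+1}|)%:R.
have m0 : 0 < m.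
  by rewrite ltr0n card_ffun expn_gt0 card_ord.
pose t := beta n / m.
have t0 : 0 < t by rewrite divr_gt0.
have Nge : 0 <= N%:R `^ (- (1 / 2)) :> R by exact: powR_ge0.
rewrite ge0_integral_sum//; last by move=> j; exact: mdevn.
(* [b j] is positive and at least the mean [t] of beta over the cells, so that
   b^al <= t^(al-1) b: this makes the sum of the b^al linear in [pi]. *)
pose b j := fine (pi (@cell R d k n j)) + t.
have bt j : t <= b j by rewrite lerDr fine_ge0.
have b0 j : 0 < b j by exact: lt_le_trans (bt j).
apply: (@le_trans _ _ (\sum_j (Num.sqrt (12 * S * H) * b j `^ al * N%:R `^ (- (1 / 2)))%:E)%E).
  apply: lee_sum => j _.
  have pb : fine (pi (cell n j)) <= b j by rewrite lerDl ltW.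
  have := empirical_dev_le hX hpi r0 s0 rs H0 mh hH nu_h tau0 tauS L2decay
    (mcell n j) (b0 j) pb N1.
  rewrite -/al; apply: le_trans.
  rewrite le_eqVlt; apply/orP; left; apply/eqP; apply: eq_integral => w _.
  by rewrite empE piA// -EFinB.
rewrite sumEFin lee_fin -mulr_suml ler_wpM2r// -mulr_sumr /C2 -!mulrA.
apply: ler_wpM2l; first exact: sqrtr_ge0.
have bal j : b j `^ al <= t `^ (al - 1) * b j.
  have -> : b j `^ al = b j `^ (al - 1) * b j.
    by rewrite -[X in _ = _ * X]powRr1 ?(ltW (b0 j))// -powRD ?subrK// gt_eqF// implybT.
  apply: ler_wpM2r; first exact: ltW.
  rewrite -opprB !powRN lef_pV2 ?posrE ?powR_gt0//.
  by apply: ge0_ler_powR; [rewrite subr_ge0 ltW|rewrite nnegrE ltW|rewrite nnegrE ltW|exact: bt].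
apply: le_trans (ler_sum _ (fun j _ => bal j)) _.
rewrite -mulr_sumr /b big_split/= sumr_const -[t *+ _]mulr_natl -/m.
have -> : m * t = beta n by rewrite /t mulrC divfK// gt_eqF.
have -> : \sum_j fine (pi (@cell R d k n j)) = fine (pi (shell_set n)).
  apply: EFin_inj; rewrite -piA// (shell_set_cells k) -sumEFin.
  by apply: eq_bigr => j _; rewrite -piA.
have tE : t `^ (al - 1) * beta n = m `^ (1 - al) * (K `^ al * exp2 (- (qr * n%:R / 2))).
  rewrite -beta_al /t powRM ?invr_ge0 ?(ltW (beta0 n)) ?(ltW m0)//.
  rewrite -powR_inv1 ?(ltW m0)// -powRrM mulN1r opprB mulrAC mulrC; congr (_ * _).
  rewrite -[X in _ * X]powRr1 ?(ltW (beta0 n))// -powRD ?subrK//.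
  by rewrite gt_eqF ?implybT.
apply: (@le_trans _ _ (2 * (t `^ (al - 1) * beta n))).
  rewrite mulrCA; apply: ler_wpM2l; first exact: powR_ge0.
  by rewrite mulr_natl mulr2n lerD2r; exact: tail.
rewrite tE; apply: ler_wpM2l => //.
rewrite mulrCA; apply: ler_wpM2l; first exact: powR_ge0.
apply: le_trans (ler_wpM2r (powR_ge0 _ _) (card_cells k)) _.
by rewrite -!exp2D; apply: ler_exp2; rewrite le_eqVlt; apply/orP; left; apply/eqP;
  rewrite /dr /qr; field; rewrite gt_eqF.
Qed.

Let C1_ge0 : 0 <= C1.
Proof. by rewrite mulr_ge0 ?sqr_ge0// addr_ge0// mulr_ge0// ltW. Qed.

Let C2_ge0 : 0 <= C2.
Proof. by rewrite !mulr_ge0 ?sqrtr_ge0 ?powR_ge0. Qed.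

Let cell_sum_min N v k n : (1 <= N)%N -> exp2 v = N%:R ->
  (\int[Pr]_w cell_sum N k n w <= ((C1 + C2) *
     exp2 (Num.min (- (qr * n%:R)) (dr * k%:R / 2 - qr * n%:R / 2 - v / 2)))%:E)%E.
Proof.
move=> N1 vN; rewrite -exp2_min; case: (leP (exp2 _) (exp2 _)) => _.
  apply: le_trans (cell_sum_shell k n N1) _; rewrite lee_fin.
  by apply: ler_wpM2r; [exact: powR_ge0|rewrite lerDl].
apply: le_trans (cell_sum_scale k n N1) _; rewrite lee_fin.
rewrite -vN /exp2 -powRrM -/(exp2 _) -[X in _ * X]/(exp2 _) -mulrA -exp2D.
rewrite (_ : v * - (1 / 2) = - (v / 2)); last by field.
by apply: ler_wpM2r; [exact: powR_ge0|rewrite lerDr].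
Qed.

Let emp1 N w : (1 <= N)%N -> emp N w setT = 1%E.
Proof.
move=> N1; rewrite empE (eq_bigr (fun=> 1)); last by move=> n _; rewrite indicE in_setT.
by rewrite sumr_const_nat subn0 mulVf// pnatr_eq0 -lt0n.
Qed.

(** What remains after the expectations have been taken is a purely numerical
    sum, for which [b] is any bound. *)
Lemma transport_risk_le : p < qr -> exists2 C, 0 <= C &
  forall N v L b, (1 <= N)%N -> exp2 v = N%:R ->
  (forall M, \sum_(0 <= k < L) \sum_(0 <= n < M) scale_term p qr dr v k n <= b) ->
  (\int[Pr]_w transport p (emp N w) pi <= (C * (b + exp2 (- (p * L%:R))))%:E)%E.
Proof.
move=> pq.
pose Kp : R := (2 * Num.sqrt d%:R) `^ p.
have Kp0 : 0 <= Kp by exact: powR_ge0.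
have lcE k n : level_cost (d := d) p k n = Kp * exp2 (p * (n%:R - k%:R)) by [].
have lc0 k n : 0 <= level_cost (d := d) p k n by exact: level_cost_ge0.
have qp0 : 0 < qr - p by rewrite subr_gt0.
have [c c0 hc] := geometric_sum_le qp0.
have C12 : 0 <= C1 + C2 by exact: addr_ge0.
exists (Kp * (C1 + C2) + Kp * C1 * c) => [|N v L b N1 vN hb].
  by apply: addr_ge0; [exact: mulr_ge0|apply: mulr_ge0 => //; exact: mulr_ge0].
pose U w : \bar R := (\sum_(k < L) \sum_(n <oo) (level_cost (d := d) p k n)%:E * cell_sum N k n w)%E.
pose V w : \bar R := (\sum_(n <oo) (level_cost (d := d) p L n)%:E *
  (emp N w (shell_set n) + pi (shell_set n)))%E.
have ul0 k n w : (0 <= (level_cost (d := d) p k n)%:E * cell_sum N k n w)%E.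
  by rewrite mule_ge0// lee_fin.
have vl0 n w : (0 <= (level_cost (d := d) p L n)%:E * (emp N w (shell_set n) + pi (shell_set n)))%E.
  by rewrite mule_ge0 ?lee_fin// adde_ge0.
have mul k n : measurable_fun setT (fun w => ((level_cost (d := d) p k n)%:E * cell_sum N k n w)%E).
  by apply: measurable_funeM; exact: mcell_sum.
have mvl n : measurable_fun setT (fun w => ((level_cost (d := d) p L n)%:E *
    (emp N w (shell_set n) + pi (shell_set n)))%E).
  by apply: measurable_funeM; apply: emeasurable_funD => //; exact: memp.
have musum k : measurable_fun setT
    (fun w => (\sum_(n <oo) (level_cost (d := d) p k n)%:E * cell_sum N k n w)%E).
  by apply: ge0_emeasurable_sum => // n w _ _; exact: ul0.
have us0 k w : (0 <= \sum_(n <oo) (level_cost (d := d) p k n)%:E * cell_sum N k n w)%E.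
  by apply: nneseries_ge0 => n _ _; exact: ul0.
apply: (@le_trans _ _ (\int[Pr]_w (U w + V w))%E).
  apply: ge0_le_integral_nomeas => w.
    apply: le_ereal_inf_tmp => _ [xi _ <-].
    by apply: integral_ge0 => z _; rewrite lee_fin powR_ge0.
  by apply: transport_le_multiscale; [exact: ltW|exact: emp1|exact: probability_setT].
rewrite ge0_integralD//; first last.
- by apply: ge0_emeasurable_sum => // n w _ _; exact: vl0.
- by move=> w _; apply: nneseries_ge0 => n _ _; exact: vl0.
- by apply: emeasurable_sum => k; exact: musum.
- by move=> w _; apply: sume_ge0 => k _; exact: us0.
have b_ge0 : 0 <= b.
  by apply: le_trans (hb 0%N); apply: sumr_ge0 => k _; rewrite big_nil.
have e0 : 0 <= exp2 (- (p * L%:R)) by exact: powR_ge0.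
apply: (@le_trans _ _ ((Kp * (C1 + C2) * b)%:E + (Kp * C1 * c * exp2 (- (p * L%:R)))%:E)%E); last first.
  rewrite -EFinD lee_fin.
  have h1 : 0 <= Kp * (C1 + C2) by exact: mulr_ge0.
  have h2 : 0 <= Kp * C1 * c by apply: mulr_ge0 => //; exact: mulr_ge0.
  have := mulr_ge0 h1 e0; have := mulr_ge0 h2 b_ge0; lra.
apply: leeD.
- rewrite ge0_integral_sum//.
  under eq_bigr => k _ do rewrite integral_nneseries//.
  rewrite -nneseries_sum; last by move=> k n _; apply: integral_ge0 => w _; exact: ul0.
  apply: nneseries_le_partial => [n|M].
    by apply: sume_ge0 => k _; apply: integral_ge0 => w _; exact: ul0.
  apply: (@le_trans _ _ (\sum_(0 <= n < M) \sum_(k < L)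
      (Kp * (C1 + C2) * scale_term p qr dr v k n)%:E)%E).
    apply: lee_sum => n _; apply: lee_sum => k _.
    rewrite ge0_integralZl_EFin//.
    apply: le_trans (lee_wpmul2l _ (cell_sum_min k n N1 vN)) _; first by rewrite lee_fin.
    rewrite -EFinM lee_fin lcE le_eqVlt; apply/orP; left; apply/eqP.
    by rewrite /scale_term; ring.
  under eq_bigr do rewrite sumEFin.
  rewrite sumEFin lee_fin exchange_big/=.
  under eq_bigr do rewrite -mulr_sumr.
  rewrite -mulr_sumr; apply: ler_wpM2l; first exact: mulr_ge0.
  by have := hb M; rewrite big_mkord.
- rewrite integral_nneseries//.
  apply: nneseries_le_partial => [n|M].
    by apply: integral_ge0 => w _; exact: vl0.
  apply: (@le_trans _ _ (\sum_(0 <= n < M)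
      (Kp * C1 * (exp2 (- ((qr - p) * n%:R)) * exp2 (- (p * L%:R))))%:E)%E).
    apply: lee_sum => n _.
    rewrite ge0_integralZl_EFin//; last 2 first.
    + by move=> w _; rewrite adde_ge0.
    + by apply: emeasurable_funD => //; exact: memp.
    apply: le_trans (lee_wpmul2l _ (shell_mass n N1)) _; first by rewrite lee_fin.
    rewrite -EFinM lee_fin lcE -exp2D le_eqVlt; apply/orP; left; apply/eqP.
    rewrite mulrACA -exp2D; congr (_ * exp2 _); ring.
  rewrite sumEFin lee_fin -mulr_sumr -mulr_suml -[leRHS]mulrA.
  by apply: ler_wpM2l; [exact: mulr_ge0|exact: ler_wpM2r].
Qed.

End multiscale_risk.

(** * Conclusion *)

(** The constant of each regime comes from lemmas that assume the regime, but
    the theorem asks for one constant chosen beforehand. *)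
Lemma exists_bound_if (R : realType) (I : Type) (A : Prop) (B : I -> R -> Prop) :
  (A -> exists2 C, 0 <= C & forall i, B i C) ->
  exists2 C, 0 <= C & A -> forall i, B i C.
Proof.
move=> h; have [a|na] := pselect A; last by exists 0.
by have [C C0 hC] := h a; exists C.
Qed.

Theorem theorem15 (R : realType) (p r q : R) (d : nat)
    (hp : 1 <= p) (hd : (1 <= d)%N) (hr : 2 < r)
    (dO : measure_display) (Omega : measurableType dO)
    (Pr : probability Omega R)
    (P : R.-pker (d.-tuple R) ~> (d.-tuple R))
    (nu pi : probability (d.-tuple R) R)
    (X : nat -> {RV Pr >-> d.-tuple R})
    (hX : markov_chain Pr P nu X)
    (hpi : invariant_measure P pi)
    (hpi_unique : forall pi' : probability (d.-tuple R) R, invariant_measure P pi' ->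
       forall A, measurable A -> pi' A = pi A)
    (C0 : R) (rho : nat -> R)
    (hrho_decr : forall m n, (1 <= m <= n)%N -> rho n <= rho m)
    (hrho_lim : rho @ \oo --> 0)
    (hrho_sum : (\sum_(1 <= n <oo) (rho n)%:E < +oo)%E)
    (hmix : forall n, (1 <= n)%N ->
       forall f : d.-tuple R -> R, f \in Lfun pi 2%:E ->
       ('N[pi]_(2%:E)[EFin \o (fun x => kernel_op P n f x - \int[pi]_y f y)%R]
        <= (C0 * rho n)%:E
           * 'N[pi]_(2%:E)[EFin \o (fun x => f x - \int[pi]_y f y)%R])%E)
    (hnu_ac : nu `<< pi)
    (hnu_r : ('N[pi]_(r%:E)['d (charge_of_finite_measure nu) '/d pi] < +oo)%E)
    (hq : p * r / (r - 1) < q)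
    (hMq : (moment q pi < +oo)%E) :
  let q_r := q * (r - 1) / r in
  let d_r := d%:R * (r + 1) / r in
  exists C : R, forall N : nat, (1 <= N)%N ->
    let risk := (\int[Pr]_w transport p (empirical (fun n => X n w) N) pi)%E in
    [/\ d_r / 2 < p -> q_r <> 2 * p ->
          (risk <= (C * (N%:R `^ (- (1 / 2))
                         + N%:R `^ (- ((q_r - p) / q_r))))%:E)%E,
        p = d_r / 2 -> q_r <> 2 * p ->
          (risk <= (C * (N%:R `^ (- (1 / 2)) * ln (1 + N%:R)
                         + N%:R `^ (- ((q_r - p) / q_r))))%:E)%E
      & 0 < p < d_r / 2 -> q_r <> d_r * p / (d_r - p) ->
          (risk <= (C * (N%:R `^ (- (p / d_r))
                         + N%:R `^ (- ((q_r - p) / q_r))))%:E)%E].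

Proof.
move=> q_r d_r.
have p0 : 0 < p by exact: lt_le_trans hp.
have r0 : 0 < r by apply: lt_trans hr; rewrite ltr0n.
have r1 : 0 < r - 1 by rewrite subr_gt0; apply: lt_trans hr; rewrite ltr1n.
have pqr : p < q_r.
  by rewrite /q_r ltr_pdivlMr// -ltr_pdivrMr.
have q0 : 0 < q by apply: lt_trans hq; rewrite divr_gt0// mulr_gt0.
have dr1 : 1 < d_r.
  rewrite /d_r ltr_pdivlMr// mul1r; apply: (@lt_le_trans _ _ (r + 1)); first by rewrite ltrDl.
  by rewrite ler_peMl ?ler1n// addr_ge0// ltW.
have dr0 : 0 < d_r by exact: lt_trans dr1.
have [K K0 tail] := shell_tail_le (ltW q0) hMq.
have [H H0 hH] := density_Lr r0 hnu_ac hnu_r.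
have [S tauS] := decay_rate_summable C0 hrho_decr hrho_lim hrho_sum.
have [C C_ge0 risk_le] := transport_risk_le hX hpi p0 hr H0 (measurable_density hnu_ac) hH
  (integral_density_le hnu_ac) (decay_rate_gt0 C0 hrho_decr hrho_lim) tauS
  (L2_decay hrho_decr hrho_lim hmix) K0 tail pqr.
pose v N : R := ln N%:R / ln 2.
have ln2 : 0 < ln 2 :> R by rewrite ln_gt0// ltr1n.
have N_gt0 N : (1 <= N)%N -> 0 < N%:R :> R by rewrite ltr0n.
have vE N : (1 <= N)%N -> exp2 (v N) = N%:R.
  move=> N1; rewrite /exp2 /powR pnatr_eq0/= /v divfK ?gt_eqF// lnK// posrE; exact: N_gt0.
have v0 N : (1 <= N)%N -> 0 <= v N.
  by move=> N1; rewrite divr_ge0 ?ln_ge0 ?ler1n// ltW.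
have powN N x : (1 <= N)%N -> N%:R `^ x = exp2 (v N * x).
  by move=> N1; rewrite -(vE _ N1) /exp2 -powRrM.
(* L is logarithmic in N, and 2^L >= N makes the remainder 2^(-p L) at most
   1 / N. *)
pose L N := up_log 2 N.
have depth N : (1 <= N)%N -> exp2 (- (p * (L N)%:R)) <= exp2 (- v N).
  move=> N1; apply: (@le_trans _ _ (exp2 (- (L N)%:R))).
    by apply: ler_exp2; rewrite lerN2 ler_peMl.
  rewrite !exp2N lef_pV2 ?posrE ?powR_gt0// vE// /exp2 powR_mulrn// -natrX ler_nat.
  exact: up_logP.
have depth_half N : (1 <= N)%N -> exp2 (- (p * (L N)%:R)) <= exp2 (- (v N / 2)).
  move=> N1; apply: le_trans (depth N N1) _; apply: ler_exp2.
  by have := v0 N N1; lra.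
have [c1 c10 bound1] : exists2 C, 0 <= C & (d_r / 2 < p /\ q_r <> 2 * p ->
    forall N, (1 <= N)%N ->
    (\int[Pr]_w transport p (empirical (fun n => X n w) N) pi <=
     (C * (N%:R `^ (- (1 / 2)) + N%:R `^ (- ((q_r - p) / q_r))))%:E)%E).
  apply: exists_bound_if => -[dp q2p].
  have [c c0 hc] := scale_sum_large p0 pqr (ltW dr0) dp q2p.
  exists (C * (c + 1)) => [|N N1]; first by rewrite mulr_ge0// addr_ge0.
  apply: le_trans (risk_le N (v N) (L N) _ N1 (vE N N1) (hc _ (L N))) _.
  rewrite lee_fin -[leRHS]mulrA; apply: ler_wpM2l => //; rewrite !powN//.
  rewrite (_ : v N * - (1 / 2) = - (v N / 2)); last by field.
  rewrite (_ : v N * - ((q_r - p) / q_r) = - ((q_r - p) / q_r * v N)); last by ring.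
  rewrite [leRHS]mulrDl mul1r lerD2l; apply: le_trans (depth_half N N1) _.
  by rewrite lerDl powR_ge0.
have [c2 c20 bound2] : exists2 C, 0 <= C & (p = d_r / 2 /\ q_r <> 2 * p ->
    forall N, (1 <= N)%N ->
    (\int[Pr]_w transport p (empirical (fun n => X n w) N) pi <=
     (C * (N%:R `^ (- (1 / 2)) * ln (1 + N%:R) + N%:R `^ (- ((q_r - p) / q_r))))%:E)%E).
  apply: exists_bound_if => -[dp q2p].
  have [c c0 hc] := scale_sum_critical p0 pqr q2p.
  have drE : d_r = 2 * p by rewrite dp; field.
  rewrite -drE in hc.
  exists (C * (2 * (c + 1) / ln 2 + c)) => [|N N1].
    by rewrite mulr_ge0// addr_ge0// divr_ge0 ?mulr_ge0 ?addr_ge0// ltW.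
  apply: le_trans (risk_le N (v N) (L N) _ N1 (vE N N1) (hc _ (L N))) _.
  rewrite lee_fin -[leRHS]mulrA; apply: ler_wpM2l => //; rewrite !powN//.
  rewrite (_ : v N * - (1 / 2) = - (v N / 2)); last by field.
  rewrite (_ : v N * - ((q_r - p) / q_r) = - ((q_r - p) / q_r * v N)); last by ring.
  set e1 := exp2 (- (v N / 2)); set e2 := exp2 (- ((q_r - p) / q_r * v N)).
  have e10 : 0 <= e1 by exact: powR_ge0.
  have e20 : 0 <= e2 by exact: powR_ge0.
  pose l := ln (1 + N%:R) / ln 2 : R.
  have lN : ln N%:R <= ln (1 + N%:R) :> R.
    by rewrite ler_ln ?posrE ?N_gt0 ?addr_gt0// ?N_gt0// lerDr.
  have l2 : ln 2 <= ln (1 + N%:R) :> R.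
    rewrite ler_ln ?posrE ?addr_gt0 ?N_gt0//.
    by rewrite -[leLHS]/(1 + 1) lerD2l ler1n.
  have l1 : 1 <= l by rewrite ler_pdivlMr// mul1r.
  have LN : (L N)%:R <= 2 * l.
    have [N2|] := ltnP 1 N; last first.
      move=> N2; have -> : N = 1%N by apply/eqP; rewrite eqn_leq N2.
      by rewrite /L up_log1 mulr_ge0// (le_trans ler01).
    have L0 : (0 < L N)%N by rewrite up_log_gt0.
    have := up_log_gtn (isT : (1 < 2)%N) N2; rewrite -(ltr_nat R) natrX => /ltW.
    rewrite -ler_ln ?posrE ?exprn_gt0 ?N_gt0// lnXn// => hL.
    have hL2 : (L N).-1%:R <= l.
      by rewrite ler_pdivlMr// mulr_natl (le_trans hL).
    by rewrite -(prednK L0) -natr1; lra.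
  have h1 : (L N)%:R * e1 <= 2 * l * e1 by exact: ler_wpM2r.
  have h2 : exp2 (- (p * (L N)%:R)) <= l * e1.
    apply: le_trans (depth_half N N1) _; rewrite -[leLHS]mul1r; exact: ler_wpM2r.
  have h3 := ler_wpM2l c0 h1.
  have le0 : 0 <= l * e1 by rewrite mulr_ge0// (le_trans ler01).
  rewrite (_ : (2 * (c + 1) / ln 2 + c) * (e1 * ln (1 + N%:R) + e2) =
    2 * (c + 1) * (l * e1) + 2 * (c + 1) / ln 2 * e2 + c * (e1 * ln (1 + N%:R)) + c * e2); last first.
    by rewrite /l; field; rewrite gt_eqF.
  have h4 : 0 <= 2 * (c + 1) / ln 2 * e2.
    by rewrite mulr_ge0// divr_ge0 ?mulr_ge0 ?addr_ge0// ltW.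
  have h5 : 0 <= c * (e1 * ln (1 + N%:R)).
    by rewrite !mulr_ge0// (le_trans _ l2)// ltW.
  lra.
have [c3 c30 bound3] : exists2 C, 0 <= C &
    (0 < p < d_r / 2 /\ q_r <> d_r * p / (d_r - p) ->
    forall N, (1 <= N)%N ->
    (\int[Pr]_w transport p (empirical (fun n => X n w) N) pi <=
     (C * (N%:R `^ (- (p / d_r)) + N%:R `^ (- ((q_r - p) / q_r))))%:E)%E).
  apply: exists_bound_if => -[/andP[_ dp] qne].
  have [c c0 hc] := scale_sum_small p0 pqr dp qne.
  exists (C * (c + 1)) => [|N N1]; first by rewrite mulr_ge0// addr_ge0.
  apply: le_trans (risk_le N (v N) (L N) _ N1 (vE N N1) (hc _ (L N))) _.
  rewrite lee_fin -[leRHS]mulrA; apply: ler_wpM2l => //; rewrite !powN//.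
  rewrite (_ : v N * - (p / d_r) = - (p / d_r * v N)); last by ring.
  rewrite (_ : v N * - ((q_r - p) / q_r) = - ((q_r - p) / q_r * v N)); last by ring.
  rewrite [leRHS]mulrDl mul1r lerD2l; apply: le_trans (depth N N1) _.
  apply: (@le_trans _ _ (exp2 (- (p / d_r * v N)))); last by rewrite lerDl powR_ge0.
  apply: ler_exp2; rewrite lerN2 ler_piMl ?v0// ler_pdivrMr// mul1r; lra.
exists (c1 + c2 + c3) => N N1 risk.
have rate0 a b : 0 <= N%:R `^ a + N%:R `^ b :> R by rewrite addr_ge0// powR_ge0.
split.
- move=> h1 h2; apply: le_trans (bound1 (conj h1 h2) N N1) _.
  by rewrite lee_fin; apply: ler_wpM2r => //; lra.
- move=> h1 h2; apply: le_trans (bound2 (conj h1 h2) N N1) _.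
  rewrite lee_fin; apply: ler_wpM2r; last by lra.
  by rewrite addr_ge0 ?mulr_ge0 ?powR_ge0 ?ln_ge0// lerDl.
- move=> h1 h2; apply: le_trans (bound3 (conj h1 h2) N N1) _.
  by rewrite lee_fin; apply: ler_wpM2r => //; lra.
Qed.
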